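(* Let $\mathcal F=(F_1,F_2)$ be a pair of finite sets of positive integers and $\alpha,\beta$ real numbers satisfying (A1) and (A2). Then the polynomials $P^{\alpha,\beta;\mathcal F}_n$, $n\in\sigma_{\mathcal F}$ (of degree $n$), are common eigenfunctions of the second order differential operator $$D_{\mathcal F}=(1-x^2)\partial^2+h_1(x)\partial+h_0(x),\qquad\partial=d/dx,$$ $$h_1(x)=\beta-\alpha-2k_2-(\alpha+\beta+2k_1+2)x-2(1-x^2)\frac{\Omega_{\mathcal F}'(x)}{\Omega_{\mathcal F}(x)},$$ $$h_0(x)=-\lambda(k_1)+\big[\alpha-\beta+2k_2+(2k_1+\alpha+\beta)x\big]\frac{\Omega_{\mathcal F}'(x)}{\Omega_{\mathcal F}(x)}+(1-x^2)\frac{\Omega_{\mathcal F}''(x)}{\Omega_{\mathcal F}(x)},$$ where $\Omega_{\mathcal F}=\Omega^{\alpha,\beta}_{\mathcal F}$. More precisely $D_{\mathcal F}(P^{\alpha,\beta;\mathcal F}_n)=-\lambda(n-u_{\mathcal F})P^{\alpha,\beta;\mathcal F}_n$ for $n\in\sigma_{\mathcal F}$.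
   Context: $(a)_0=1$, $(a)_j=a(a+1)\cdots(a+j-1)$. $\lambda(x)=\lambda^{\alpha,\beta}(x)=x(x+\alpha+\beta+1)$. Jacobi polynomials: $P^{a,b}_n(x)=2^{-n}\sum_{j=0}^n\binom{n+a}{j}\binom{n+b}{n-j}(x-1)^{n-j}(x+1)^j$. A pair $\mathcal F=(F_1,F_2)$ consists of finite sets of positive integers, not both empty, $F_i=\{f^{(i)}_1<\dots<f^{(i)}_{k_i}\}$, $k=k_1+k_2$. $u_{\mathcal F}=\sum_{f\in F_1}f+\sum_{f\in F_2}f-\binom{k_1+1}{2}-\binom{k_2}{2}$; $\sigma_{\mathcal F}=\{u_{\mathcal F},u_{\mathcal F}+1,\dots\}\setminus\{u_{\mathcal F}+f:f\in F_1\}$. (A1): $\alpha,\beta,\alpha+\beta\notin\{-1,-2,\dots\}$. (A2): if $F_2\ne\emptyset$, then $\alpha-\beta\notin\{-1,-2,\dots\}$ and $\beta-f^{(2)}_{k_2}-1\notin\{-1,-2,\dots\}$. $P^{\alpha,\beta;\mathcal F}_n(x)=\det M_n(x)/(1+x)^{k_2(k_2-1)}$, where $M_n(x)$ is the $(k+1)\times(k+1)$ matrix with columns $j=1,\dots,k+1$, first row $\big((-1)^{j-1}(P^{\alpha,\beta}_{n-u_{\mathcal F}})^{(j-1)}(x)\big)_j$, then for $f\in F_1$ increasing rows $\big((-1)^{j-1}(P^{\alpha,\beta}_f)^{(j-1)}(x)\big)_j$, then for $f\in F_2$ increasing rows $\big((\beta-f)_{j-1}(1+x)^{k-j+1}P^{\alpha+j-1,-\beta-j+1}_f(x)\big)_j$.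 $\Omega^{\alpha,\beta}_{\mathcal F}(x)=\det W(x)/(1+x)^{k_2(k_2-1)}$, where $W(x)$ is the $k\times k$ matrix with columns $j=1,\dots,k$ whose rows are, for $f\in F_1$ increasing, $\big((-1)^{j-1}(P^{\alpha,\beta}_f)^{(j-1)}(x)\big)_j$, followed by, for $f\in F_2$ increasing, $\big((\beta-f)_{j-1}(1+x)^{k-j}P^{\alpha+j-1,-\beta-j+1}_f(x)\big)_j$. *)

(* Defs.v *)
From HB Require Import structures.
From mathcomp Require Import all_boot all_order all_algebra.
Set Implicit Arguments. Unset Strict Implicit. Unset Printing Implicit Defensive.
Import Order.TTheory GRing.Theory Num.Theory.
Local Open Scope ring_scope.

Section JacobiDefs.
Variable R : realFieldType.

Definition poch (a : R) (j : nat) : R := \prod_(i < j) (a + i%:R).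

Definition gbinom (a : R) (j : nat) : R := (\prod_(i < j) (a - i%:R)) / (j`!)%:R.

Definition jacobi (a b : R) (n : nat) : {poly R} :=
  (2%:R ^- n) *: \sum_(j < n.+1)
     (gbinom (n%:R + a) j * gbinom (n%:R + b) (n - j)) *:
       (('X - 1) ^+ (n - j) * ('X + 1) ^+ j).

Definition lam (al be x : R) : R := x * (x + al + be + 1).

Definition negint (x : R) : Prop := exists m : nat, x = - (m.+1)%:R.

Definition posset (s : seq nat) : bool := sorted ltn s && all (fun f => 0 < f)%N s.

Definition uF (F1 F2 : seq nat) : nat :=
  (\sum_(f <- F1) f + \sum_(f <- F2) f - 'C((size F1).+1, 2) - 'C(size F2, 2))%N.

Definition in_sigma (F1 F2 : seq nat) (n : nat) : bool :=
  (uF F1 F2 <= n)%N && ((n - uF F1 F2)%N \notin F1).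

(* Row of type F1 (column index j is 0-based, i.e. j = paper's j-1). *)
Definition rowF1 (al be : R) (f j : nat) : {poly R} :=
  (-1) ^+ j *: (jacobi al be f)^`(j).

Definition rowF2 (al be : R) (f j e : nat) : {poly R} :=
  poch (be - f%:R) j *: ((1 + 'X) ^+ e * jacobi (al + j%:R) (- be - j%:R) f).

(* The (k+1)x(k+1) matrix M_n(x); row 0 is the first row, rows 1..k1 for F1,
   rows k1+1..k for F2; column j : 'I_(k+1) corresponds to paper's j+1. *)
Definition Mmat (al be : R) (F1 F2 : seq nat) (n : nat) :
    'M[{poly R}]_((size F1 + size F2).+1) :=
  let k1 := size F1 in let k := (size F1 + size F2)%N in
  \matrix_(i, j)
    if (i : nat) == 0%N then rowF1 al be (n - uF F1 F2) j
    else if (i.-1 < k1)%N then rowF1 al be (nth 0%N F1 i.-1) j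
    else rowF2 al be (nth 0%N F2 (i.-1 - k1)) j (k - j).

Definition Wmat (al be : R) (F1 F2 : seq nat) :
    'M[{poly R}]_(size F1 + size F2) :=
  let k1 := size F1 in let k := (size F1 + size F2)%N in
  \matrix_(i, j)
    if (i < k1)%N then rowF1 al be (nth 0%N F1 i) j
    else rowF2 al be (nth 0%N F2 (i - k1)) j (k - j.+1).

(* P^{alpha,beta;F}_n (the division by (1+x)^{k2(k2-1)} is exact). *)
Definition PF (al be : R) (F1 F2 : seq nat) (n : nat) : {poly R} :=
  \det (Mmat al be F1 F2 n) %/ (1 + 'X) ^+ (size F2 * (size F2).-1).

Definition OmegaF (al be : R) (F1 F2 : seq nat) : {poly R} :=
  \det (Wmat al be F1 F2) %/ (1 + 'X) ^+ (size F2 * (size F2).-1).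

End JacobiDefs.

(* Main.v *)
Require Import Defs.
From HB Require Import structures.
From mathcomp Require Import all_boot all_order all_algebra.
From mathcomp Require Import ring zify.
Import Order.TTheory GRing.Theory Num.Theory.
Local Open Scope ring_scope.
Set Implicit Arguments. Unset Strict Implicit. Unset Printing Implicit Defensive.

(** The rows of [Mmat] and [Wmat] are, up to sign and powers of [1+x], the jets
    of eigenfunctions of the Jacobi operator [(1-x^2)d^2 + q d]: the [F1] rows
    come from Jacobi polynomials and the [F2] rows from the functions
    [(1+x)^(-be) P_f^(al,-be)(x)].  So [PF / OmegaF] is, up to a power of [1+x],
    Crum's (Darboux) transform [z = T y], where [T] is the monic differential
    operator that kills all seed functions.  As the Jacobi operator [L] preserves
    the kernel of [T], one has [Lhat T = T L] for a second order operator [Lhat]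
    whose coefficients are read off from the leading terms of both sides;
    conjugating by [OmegaF] and a power of [1+x] gives the operator of the theorem.

    Everything is done over the field of rational functions.  The non-rational
    factor [(1+x)^(-be)] is gauged away: the derivation acts on an [F2] row as
    [d - be/(1+x)], i.e. as a diagonal connection on column vectors.

    For the degree, the coefficient of the determinant at the expected degree is a
    product of leading coefficients of Jacobi polynomials and a Vandermonde
    determinant in Pochhammer symbols.  That [(1+x)^(k2(k2-1))] divides the
    determinants follows by replacing the [F2] seeds by linear combinations that
    vanish at [-1] to orders [0, 1, ..., k2-1]. *)

(** * Differential operators and Crum's theorem *)

(** Cramer's rule: applying the adjugate to [A u = z e_0] and reading the last coordinate leaves [z]
    times a single cofactor. *)
Lemma det_mul_delta (R : comNzRingType) n (A : 'M[R]_n.+1) (u : 'cV[R]_n.+1) z :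
    u ord_max 0 = 1 -> A *m u = z *: delta_mx ord0 0 ->
  \det A = (-1) ^+ n * z * \det (row' ord0 (col' ord_max A)).
Proof.
move=> u1 Au; have /matrixP/(_ ord_max 0) : \adj A *m (A *m u) = \det A *: u.
  by rewrite mulmxA mul_adj_mx mul_scalar_mx.
rewrite Au -scalemxAr !mxE u1 mulr1 => <-.
rewrite (bigD1 ord0) //= big1 => [|i /negPf i0]; last by rewrite !mxE i0 mulr0.
by rewrite addr0 !mxE eqxx mulr1 /cofactor add0n mulrCA mulrA.
Qed.

Section DifferentialOperators.
Variables (K : fieldType) (d : {additive K -> K}).
Hypothesis dM : forall x y, d (x * y) = d x * y + x * d y.

Lemma deriv_one : d 1 = 0.
Proof. by apply: (addrI (d 1)); rewrite addr0 -[in RHS](mulr1 1) dM mulr1 mul1r. Qed.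

Lemma deriv_nat n : d n%:R = 0.
Proof. by rewrite raddfMn deriv_one mul0rn. Qed.

Lemma deriv_inv x : x != 0 -> d x^-1 = - d x / x ^+ 2.
Proof.
move=> x0; have := dM x x^-1; rewrite divff // deriv_one => H.
have -> : d x^-1 = - (d x / x) / x.
  apply: (mulfI x0); rewrite [RHS]mulrC divfK //.
  by apply/eqP; rewrite -subr_eq0 opprK addrC -H.
by field.
Qed.

(** A polynomial stands for the operator with these coefficients written on the left of the powers
    of the derivation. This is composition on the left with the derivation:
    [d o (a d^j) = (d a) d^j + a d^(j+1)]. *)
Definition op_deriv (A : {poly K}) : {poly K} := map_poly d A + 'X * A.

Lemma coef_op_deriv (A : {poly K}) m :
  (op_deriv A)`_m = d A`_m + (if m == 0 then 0 else A`_m.-1).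
Proof. by rewrite coefD coefXM coef_map_id0 ?raddf0. Qed.

Lemma size_op_deriv (A : {poly K}) n : (size A <= n -> size (op_deriv A) <= n.+1)%N.
Proof.
move=> /leq_sizeP sA; apply/leq_sizeP => m lt_nm.
rewrite coef_op_deriv sA 1?ltnW // raddf0 add0r.
by case: m lt_nm => [//|m] /=; rewrite ltnS; apply: sA.
Qed.

(** * Operators acting on a module over the differential field *)

Section DModule.
Variables (V : lmodType K) (nabla : {additive V -> V}).
Hypothesis nablaZ : forall a v, nabla (a *: v) = d a *: v + a *: nabla v.

Definition act (A : {poly K}) (v : V) : V :=
  \sum_(j < size A) A`_j *: iter j nabla v.

Lemma actE n (A : {poly K}) v : (size A <= n)%N ->
  act A v = \sum_(j < n) A`_j *: iter j nabla v.
Proof.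
move=> sA; rewrite /act (big_ord_widen _ (fun j => A`_j *: iter j nabla v) sA).
rewrite [RHS](bigID (fun i : 'I_n => (i < size A)%N)) /= [X in _ = _ + X]big1 ?addr0 //.
by move=> i; rewrite -leqNgt => h; rewrite nth_default // scale0r.
Qed.

Lemma actD A B v : act (A + B) v = act A v + act B v.
Proof.
set n := maxn (size A) (size B).
rewrite !(@actE n) ?size_polyD ?leq_maxl ?leq_maxr // -big_split /=.
by apply: eq_bigr => i _; rewrite coefD scalerDl.
Qed.

Lemma actZ a A v : act (a *: A) v = a *: act A v.
Proof.
rewrite !(@actE (size A)) ?size_scale_leq // scaler_sumr.
by apply: eq_bigr => i _; rewrite coefZ scalerA.
Qed.

Lemma actN A v : act (- A) v = - act A v.
Proof. by rewrite -[- A]scaleN1r actZ scaleN1r. Qed.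

Lemma act0 v : act 0 v = 0.
Proof. by rewrite /act size_poly0 big_ord0. Qed.

Lemma act_sum (I : finType) (F : I -> {poly K}) v :
  act (\sum_i F i) v = \sum_i act (F i) v.
Proof. exact: (big_morph (act^~ v) (fun A B => actD A B v) (act0 v)). Qed.

Lemma act_op_deriv A v : act (op_deriv A) v = nabla (act A v).
Proof.
rewrite (@actE (size A).+1) ?size_op_deriv // {1}/act raddf_sum.
under eq_bigr do rewrite coef_op_deriv scalerDl.
under [RHS]eq_bigr do rewrite nablaZ.
rewrite !big_split /= big_ord_recr /= [A`_(size A)]nth_default // raddf0.
by rewrite scale0r addr0 big_ord_recl /= scale0r add0r.
Qed.

Lemma act_iter_op_deriv j A v :
  act (iter j op_deriv A) v = iter j nabla (act A v).
Proof. by elim: j => //= j IHj; rewrite act_op_deriv IHj. Qed.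

Definition op_comp (A B : {poly K}) : {poly K} :=
  \sum_(j < size A) A`_j *: iter j op_deriv B.

(** Later [f] multiplies each row by its own constant eigenvalue, so that all seeds are treated at
    once. Being linear and commuting with [nabla], it passes through [A]. *)
Lemma act_comp_eigen (f : {additive V -> V}) A B v :
    (forall a w, f (a *: w) = a *: f w) -> (forall w, nabla (f w) = f (nabla w)) ->
  act B v = f v -> act (op_comp A B) v = f (act A v).
Proof.
move=> fZ fC Bv; rewrite act_sum {2}/act raddf_sum; apply: eq_bigr => j _.
rewrite actZ fZ act_iter_op_deriv Bv; congr (_ *: _).
by elim: {1 2}(j : nat) => //= i ->.
Qed.

End DModule.

(** * The second order operator and its intertwining *)

Variables p q : K.

Definition second_order : {poly K} := p *: 'X^2 + q *: 'X.

Lemma coef_second_order m :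
  second_order`_m = (m == 2)%:R * p + (m == 1)%:R * q.
Proof. by rewrite coefD !coefZ coefXn coefX ![_ * _%:R]mulrC. Qed.

Lemma size_second_order : (size second_order <= 3)%N.
Proof.
apply/leq_sizeP => m hm; rewrite coef_second_order.
by case: m hm => [|[|[|m]]] // _; rewrite !mul0r addr0.
Qed.

Lemma act_second_order (V : lmodType K) (nabla : {additive V -> V}) v :
  act nabla second_order v = p *: nabla (nabla v) + q *: nabla v.
Proof.
rewrite (actE _ _ size_second_order) !big_ord_recl big_ord0 !coef_second_order /=.
by rewrite !mul0r !mul1r !addr0 !add0r scale0r add0r addrC.
Qed.

Lemma size_iter_second_order j : (size (iter j op_deriv second_order) <= j.+3)%N.
Proof.
by elim: j => [|j IHj] /=; [exact: size_second_order | exact: size_op_deriv].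
Qed.

(** Leibniz rule for [d^j o (p d^2 + q d)] in its three highest orders; Pascal's rule produces the
    binomial in the induction. *)
Lemma coef_iter_second_order j :
  [/\ (iter j op_deriv second_order)`_j.+2 = p,
      (iter j op_deriv second_order)`_j.+1 = q + j%:R * d p &
      (iter j op_deriv second_order)`_j = j%:R * d q + 'C(j, 2)%:R * d (d p)].
Proof.
elim: j => [|j [IH2 IH1 IH0]].
  by rewrite /= !coef_second_order bin0n /= !mul0r !mul1r !addr0 add0r.
have d3 : (iter j op_deriv second_order)`_j.+3 = 0.
  exact/nth_default/size_iter_second_order.
rewrite /= !coef_op_deriv /= d3 IH2 IH1 IH0 raddf0 add0r; split=> //.
  by rewrite -natr1; ring.
by rewrite raddfD dM binS bin1 natrD -natr1 deriv_nat; ring.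
Qed.

(** [crum_q] and [crum_r] are the coefficients of orders 1 and 0 of [Lhat], for [T] monic of order
    [n] with coefficient [tau] in order [n-1]. *)
Definition crum_q (n : nat) : K := q + n%:R * d p.

Definition crum_r (n : nat) (tau : K) : K :=
  n%:R * d q + 'C(n, 2)%:R * d (d p) - d p * tau - 2%:R * p * d tau.

(* The coefficients of the transformed operator are read off by comparing the
   three highest coefficients of both sides of [Lhat T = T L]. *)
Lemma size_intertwining_defect k (T : {poly K}) :
    size T = k.+2 -> T`_k.+1 = 1 ->
  (size (p *: op_deriv (op_deriv T) + crum_q k.+1 *: op_deriv T
         + crum_r k.+1 T`_k *: T
         - op_comp T second_order)%R <= k.+1)%N.
Proof.
move=> sT Tk.
have T0 m : (k.+1 < m)%N -> T`_m = 0 by move=> h; rewrite nth_default ?sT.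
(* A term of [T] of order [j < k] yields order at most [j+2] in [T L], so above order [k] only
   [j = k-1] is felt, and only at order [k+1]. *)
have low m : (k < m)%N -> \sum_(j < k) T`_j * (iter j op_deriv second_order)`_m
    = (m == k.+1)%:R * (if k is k'.+1 then T`_k' * p else 0).
  case: k {sT Tk T0} => [|k] hm; first by rewrite big_ord0 mulr0.
  rewrite big_ord_recr /= big1 ?add0r => [|j _]; last first.
    rewrite [_`_m]nth_default ?mulr0 //; apply: leq_trans (size_iter_second_order _) _.
    by apply: leq_trans hm; rewrite !ltnS.
  have [->|ne] := eqVneq m k.+2.
    by rewrite mul1r; have [-> _ _] := coef_iter_second_order k.
  rewrite mul0r [_`_m]nth_default ?mulr0 //; apply: leq_trans (size_iter_second_order _) _.
  by rewrite ltn_neqAle eq_sym ne.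
apply/leq_sizeP => m hm.
rewrite coefB !coefD !coefZ /op_comp coef_sum sT.
under eq_bigr do rewrite coefZ.
rewrite !big_ord_recr low //= Tk mul1r.
have [Ek2 Ek1 _] := coef_iter_second_order k.
have [Es2 Es1 Es0] := coef_iter_second_order k.+1.
have big i j : (j.+2 < i)%N -> (iter j op_deriv second_order)`_i = 0.
  by move=> h; apply: nth_default; apply: leq_trans (size_iter_second_order _) _.
rewrite /= in Es2 Es1 Es0.
(* Orders [k+1], [k+2], [k+3] in turn: the first cancels by the choice of [crum_r], the second by
   that of [crum_q], the third because both leading coefficients are [p]. *)
rewrite leq_eqVlt in hm; case/predU1P: hm => [<-|hm].
  rewrite eqxx Ek1 Es0 !coef_op_deriv /= Tk /crum_q /crum_r.
  set b := 'C(_, _)%:R; move: b => b.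
  case: (k) => [|k'] /=; rewrite deriv_one ?add0r ?addr0.
    by ring.
  by rewrite -[k'.+2%:R]natr1; ring.
rewrite (gtn_eqF hm) mul0r add0r.
rewrite leq_eqVlt in hm; case/predU1P: hm => [<-|hm].
  rewrite Ek2 Es1 !coef_op_deriv /= T0 // Tk !(raddf0, add0r, deriv_one) /crum_q.
  by ring.
rewrite (big m k) //.
rewrite leq_eqVlt in hm; case/predU1P: hm => [<-|hm].
  rewrite Es2 !coef_op_deriv /= T0 // T0 // Tk !(raddf0, add0r); ring.
rewrite (big m k.+1) //.
case: m hm => [|[|m]] // hm.
have [h0 h1 h2] : [/\ T`_m.+2 = 0, T`_m.+1 = 0 & T`_m = 0].
  have hm' : (k.+1 < m)%N := hm.
  by split; apply: T0; [exact: leqW (leqW hm') | exact: leqW hm' | ].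
by rewrite !coef_op_deriv /= h0 h1 h2 raddf0 add0r raddf0; ring.
Qed.

(** Entry [i] represents a function [h_i v_i] with [h_i' = c_i h_i]; differentiating and dividing by
    [h_i] again gives [d v_i + c_i v_i], so [h_i] itself need not lie in [K]. *)
Definition conn n (c : 'I_n -> K) (v : 'cV[K]_n) : 'cV[K]_n :=
  \col_i (d (v i 0) + c i * v i 0).

Fact conn_is_zmod_morphism n (c : 'I_n -> K) : zmod_morphism (conn c).
Proof. by move=> u v; apply/matrixP => i j; rewrite !mxE raddfB; ring. Qed.

HB.instance Definition _ n c :=
  GRing.isZmodMorphism.Build 'cV[K]_n 'cV[K]_n (conn c) (@conn_is_zmod_morphism n c).

Lemma connZ n (c : 'I_n -> K) a v : conn c (a *: v) = d a *: v + a *: conn c v.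
Proof. by apply/matrixP => i j; rewrite !mxE ord1 dM; ring. Qed.

Definition jets n (c : 'I_n -> K) (v : 'cV[K]_n) m : 'M[K]_(n, m) :=
  \matrix_(i, j) iter j (conn c) v i 0.

Definition scale_rows n (l : 'I_n -> K) (v : 'cV[K]_n) : 'cV[K]_n :=
  \col_i (l i * v i 0).

Fact scale_rows_is_zmod_morphism n (l : 'I_n -> K) : zmod_morphism (scale_rows l).
Proof. by move=> u v; apply/matrixP => i j; rewrite !mxE; ring. Qed.

HB.instance Definition _ n l :=
  GRing.isZmodMorphism.Build 'cV[K]_n 'cV[K]_n (scale_rows l)
    (@scale_rows_is_zmod_morphism n l).

(* [op_comp T L] and the transformed operator composed with [T] differ by an
   operator of order at most [k]; it kills the [k+1] seed rows, whose Wronskian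
   does not vanish, so it is zero. *)
Lemma crum k (c l : 'I_k.+2 -> K) (v : 'cV[K]_k.+2) (T : {poly K}) z :
    c ord0 = 0 -> (forall i, d (l i) = 0) ->
    act (conn c) second_order v = scale_rows l v ->
    size T = k.+2 -> T`_k.+1 = 1 ->
    act (conn c) T v = z *: delta_mx ord0 0 ->
    row' ord0 (jets c v k.+1) \in unitmx ->
  p * d (d z) + crum_q k.+1 * d z + crum_r k.+1 T`_k * z = l ord0 * z.
Proof.
move=> c0 dl Lv sT Tk Tv Wu.
set D := p *: op_deriv (op_deriv T) + crum_q k.+1 *: op_deriv T
         + crum_r k.+1 T`_k *: T - op_comp T second_order.
have sD : (size D <= k.+1)%N := size_intertwining_defect sT Tk.
have cC w : conn c (scale_rows l w) = scale_rows l (conn c w).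
  by apply/matrixP => i j; rewrite !mxE dM dl; ring.
have lZ a w : scale_rows l (a *: w) = a *: scale_rows l w.
  by apply/matrixP => i j; rewrite !mxE; ring.
have Dv : act (conn c) D v = p *: conn c (conn c (z *: delta_mx ord0 0))
     + crum_q k.+1 *: conn c (z *: delta_mx ord0 0)
     + crum_r k.+1 T`_k *: (z *: delta_mx ord0 0)
     - scale_rows l (z *: delta_mx ord0 0).
  have cZ := @connZ _ c.
  rewrite actD actN (act_comp_eigen cZ T lZ cC Lv) !actD !actZ.
  by rewrite !(act_op_deriv cZ) Tv.
have D0 : D = 0.
  pose u : 'cV[K]_k.+1 := \col_j D`_j.
  have : row' ord0 (jets c v k.+1) *m u = 0.
    apply/matrixP => i j; rewrite !mxE.
    transitivity (act (conn c) D v (lift ord0 i) 0).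
      rewrite (actE _ _ sD) summxE; apply: eq_bigr => m _; rewrite !mxE.
      by rewrite mulrC.
    rewrite Dv !mxE /= !(mulr0, raddf0, addr0, subr0) //.
  move/(congr1 (mulmx (invmx (row' ord0 (jets c v k.+1))))).
  rewrite mulKmx // mulmx0 => /matrixP u0.
  apply/polyP => m; rewrite coef0; have [hm|hm] := ltnP m k.+1.
    by have := u0 (Ordinal hm) 0; rewrite !mxE.
  by rewrite nth_default // (leq_trans sD).
(* Row 0 carries the trivial connection, so its entry of [D v = 0] is the scalar equation for
   [z]. *)
have /matrixP/(_ ord0 0) := Dv; rewrite D0 act0 !mxE /= c0.
by rewrite !mul0r !addr0 !mulr1 => /esym/eqP; rewrite subr_eq0 => /eqP.
Qed.

(** * Derivative of the Wronskian and the operator annihilating the seeds *)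

Lemma deriv_prod_ord n (F : 'I_n -> K) :
  d (\prod_i F i) = \sum_i d (F i) * \prod_(j | j != i) F j.
Proof.
elim: n F => [|n IHn] F; first by rewrite !big_ord0 deriv_one.
rewrite big_ord_recl dM IHn [RHS]big_ord_recl; congr (_ + _).
  congr (_ * _); rewrite [RHS]big_mkcond big_ord_recl /= mul1r.
  by apply: eq_bigr.
rewrite mulr_sumr; apply: eq_bigr => i _.
rewrite [in RHS]big_mkcond big_ord_recl /= mulrCA [in LHS]big_mkcond.
by congr (_ * (_ * _)).
Qed.

Lemma deriv_det n (A : 'M[K]_n) :
  d (\det A) = \sum_i \sum_j d (A i j) * cofactor A i j.
Proof.
transitivity (\sum_i \det (\matrix_(r, j) if r == i then d (A r j) else A r j)).
  rewrite /determinant raddf_sum /=.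
  rewrite exchange_big /=; apply: eq_bigr => s _.
  rewrite dM; have -> : d ((-1) ^+ perm.odd_perm s) = 0
    by case: (perm.odd_perm s); rewrite /= ?raddfN ?deriv_one ?oppr0.
  rewrite mul0r add0r deriv_prod_ord mulr_sumr; apply: eq_bigr => i _.
  rewrite [in RHS](bigD1 i) //= mxE eqxx; congr (_ * (_ * _)).
  by apply: eq_bigr => j /negPf ji; rewrite mxE ji.
apply: eq_bigr => i _; rewrite (expand_det_row _ i); apply: eq_bigr => j _.
rewrite mxE eqxx; congr (_ * (_ * \det _)).
by apply/matrixP => r s; rewrite !mxE eq_sym (negPf (neq_lift _ _)).
Qed.

(** Abel-Liouville formula. Differentiating a column gives the next jet minus a connection term; the
    latter sum to the trace of [c]. In the last column [T v = 0] on the seed rows replaces the top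
    jet by lower ones, of which only the one with coefficient [T_k] counts. *)
Lemma liouville k (c : 'I_k.+2 -> K) (v : 'cV[K]_k.+2) (T : {poly K}) z :
    size T = k.+2 -> T`_k.+1 = 1 -> act (conn c) T v = z *: delta_mx ord0 0 ->
  let W := \det (row' ord0 (jets c v k.+1)) in
  d W = - (T`_k + \sum_i c (lift ord0 i)) * W.
Proof.
move=> sT Tk Tv /=; set A := row' ord0 (jets c v k.+1).
have AE i j : A i j = iter j (conn c) v (lift ord0 i) 0 by rewrite !mxE.
have adj (M : 'M[K]_k.+1) j m :
    \sum_i cofactor M i j * M i m = (\det M) *+ (j == m).
  have /matrixP/(_ j m) := mul_adj_mx M; rewrite !mxE => <-.
  by apply: eq_bigr => i _; rewrite mxE.
have dA i j : d (A i j) = iter j.+1 (conn c) v (lift ord0 i) 0 - c (lift ord0 i) * A i j.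
  by rewrite iterS [in RHS]mxE AE addrK.
have -> : d (\det A) =
   \sum_j \sum_i cofactor A i j * iter j.+1 (conn c) v (lift ord0 i) 0
   - \sum_i c (lift ord0 i) * \sum_j A i j * cofactor A i j.
  rewrite deriv_det [X in _ = X - _]exchange_big /= -sumrB; apply: eq_bigr => i _.
  rewrite mulr_sumr -sumrB; apply: eq_bigr => j _; rewrite dA; ring.
under [X in _ - X]eq_bigr do rewrite -expand_det_row.
rewrite -mulr_suml mulNr mulrDl opprD; congr (_ - _).
(* Replacing column [j < k] by its next jet repeats column [j+1], so the determinant vanishes. *)
rewrite big_ord_recr /= big1 => [|j _]; last first.
  have lj : (j.+1 < k.+1)%N by rewrite ltnS.
  have := adj A (widen_ord (leqnSn k) j) (Ordinal lj).
  rewrite -val_eqE /= ltn_eqF // mulr0n => adj0; rewrite -[RHS]adj0.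
  by apply: eq_bigr => i _; rewrite [A _ (Ordinal _)]AE.
have vk i : iter k.+1 (conn c) v (lift ord0 i) 0 = - \sum_(j < k.+1) T`_j * A i j.
  have /matrixP/(_ (lift ord0 i) 0) := Tv.
  rewrite /act sT big_ord_recr /= Tk scale1r !mxE summxE mulr0.
  move/eqP; rewrite addrC addr_eq0 => /eqP ->; congr (- _).
  by apply: eq_bigr => j _; rewrite AE mxE.
rewrite add0r; under eq_bigr do rewrite -/(iter k.+1 _ _) vk mulrN mulr_sumr.
rewrite sumrN exchange_big /=; congr (- _).
under eq_bigr => j _ do (under eq_bigr do rewrite mulrCA; rewrite -mulr_sumr adj).
rewrite (bigD1 ord_max) //= eqxx big1 ?addr0 // => j.
by rewrite eq_sym => /negPf ->; rewrite mulr0n mulr0.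
Qed.

(** The lower coefficients of [T] solve the linear system whose matrix is the invertible Wronskian
    matrix of the seeds; [z] is the value of [T] on row 0. *)
Lemma exists_annihilator k (c : 'I_k.+2 -> K) (v : 'cV[K]_k.+2) :
    row' ord0 (jets c v k.+1) \in unitmx ->
  exists (T : {poly K}) z, [/\ size T = k.+2, T`_k.+1 = 1 &
    act (conn c) T v = z *: delta_mx ord0 0].
Proof.
set A := row' ord0 _ => Au.
pose u := invmx A *m row' ord0 (iter k.+1 (conn c) v).
pose q0 : {poly K} := \poly_(j < k.+1) - u (inord j) 0.
pose T : {poly K} := 'X^(k.+1) + q0.
have sT : size T = k.+2.
  by rewrite size_polyDl size_polyXn // ltnS size_poly.
have Tk : T`_k.+1 = 1 by rewrite coefD coefXn coef_poly ltnn eqxx addr0.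
exists T, (act (conn c) T v ord0 0); split=> //.
apply/matrixP => i j; rewrite ord1 !mxE.
have [i' ->|->] := unliftP ord0 i; last by rewrite mulr1.
rewrite mulr0 /act sT big_ord_recr /= Tk scale1r mxE summxE -/(iter k.+1 _ _).
have /matrixP/(_ i' 0) := mulKVmx Au (row' ord0 (iter k.+1 (conn c) v)).
rewrite -/u mxE [RHS]mxE => <-; rewrite -big_split big1 // => m _ /=.
have -> : A i' m = iter m (conn c) v (lift ord0 i') 0 by rewrite !mxE.
have ZE a (w : 'cV[K]_k.+2) r : (a *: w) r 0 = a * w r 0 by rewrite mxE.
rewrite ZE coefD coefXn coef_poly ltn_ord (ltn_eqF (ltn_ord m)) inord_val.
by rewrite add0r mulNr mulrC addNr.
Qed.

(** Besides collecting the equation and Liouville's formula, this identifies [z] as a quotient of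
    Wronskians: the full jet matrix sends the coefficient vector of [T], whose last entry is 1, to
    [z e_0]. *)
Lemma crum_wronskian k (c l : 'I_k.+2 -> K) (v : 'cV[K]_k.+2) :
    c ord0 = 0 -> (forall i, d (l i) = 0) ->
    act (conn c) second_order v = scale_rows l v ->
  let W := \det (row' ord0 (jets c v k.+1)) in
  W != 0 ->
  exists z tau, [/\
    p * d (d z) + crum_q k.+1 * d z + crum_r k.+1 tau * z = l ord0 * z,
    d W = - (tau + \sum_i c (lift ord0 i)) * W &
    \det (jets c v k.+2) = (-1) ^+ k.+1 * z * W].
Proof.
move=> c0 dl Lv /= W0.
have Wu : row' ord0 (jets c v k.+1) \in unitmx by rewrite unitmxE unitfE.
have [T [z [sT Tk Tv]]] := exists_annihilator Wu.
exists z, T`_k; split; [exact: (crum c0 dl Lv) | exact: (liouville sT Tk Tv) |].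
have -> : row' ord0 (jets c v k.+1) = row' ord0 (col' ord_max (jets c v k.+2)).
  by apply/matrixP => i j; rewrite !mxE lift_max.
apply: (@det_mul_delta _ _ _ (\col_j T`_j)); first by rewrite mxE.
rewrite -Tv; apply/matrixP => i j; rewrite ord1 /act sT summxE !mxE.
by apply: eq_bigr => m _; rewrite !mxE mulrC.
Qed.

End DifferentialOperators.

(** * Jacobi polynomials *)

Section Binomials.
Variable R : realFieldType.
Implicit Types a b : R.

Lemma gbinom0 a : gbinom a 0 = 1.
Proof. by rewrite /gbinom big_ord0 fact0 divr1. Qed.

Lemma natS_neq0 n : n.+1%:R != 0 :> R.
Proof. by rewrite pnatr_eq0. Qed.

Lemma gbinomS a j : j.+1%:R * gbinom a j.+1 = (a - j%:R) * gbinom a j.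
Proof.
rewrite /gbinom big_ord_recr /= factS natrM.
by field; rewrite (addrC 1) natr1 natS_neq0 andbT pnatr_eq0 -lt0n fact_gt0.
Qed.

Lemma gbinomS_lower a j : j.+1%:R * gbinom (a + 1) j.+1 = (a + 1) * gbinom a j.
Proof.
rewrite /gbinom big_ord_recl /= factS natrM subr0.
under eq_bigr do rewrite /bump /= add1n -natr1 opprD addrACA subrr addr0.
by field; rewrite (addrC 1) natr1 natS_neq0 andbT pnatr_eq0 -lt0n fact_gt0.
Qed.

Lemma gbinom_upper a j : (a + 1 - j%:R) * gbinom (a + 1) j = (a + 1) * gbinom a j.
Proof. by rewrite -gbinomS gbinomS_lower. Qed.

Lemma gbinom_pascal a j : gbinom (a + 1) j.+1 = gbinom a j.+1 + gbinom a j.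
Proof.
apply: (mulfI (natS_neq0 j)); rewrite gbinomS_lower mulrDr gbinomS -natr1; ring.
Qed.

(** Chu-Vandermonde with field-valued upper arguments. Multiply by [n+1], split it as [j + (n+1-j)]
    in each term, and absorb each part into one binomial. *)
Lemma gbinom_vandermonde a b n :
  \sum_(j < n.+1) gbinom a j * gbinom b (n - j) = gbinom (a + b) n.
Proof.
elim: n a b => [|n IHn] a b; first by rewrite big_ord_recl big_ord0 !gbinom0 mulr1 addr0.
apply: (mulfI (natS_neq0 n)).
have lower (c : R) j : j.+1%:R * gbinom c j.+1 = c * gbinom (c - 1) j.
  by have := gbinomS_lower (c - 1) j; rewrite subrK.
rewrite lower.
transitivity (a * gbinom (a - 1 + b) n + b * gbinom (a + (b - 1)) n); last first.
  by rewrite [a - 1 + b]addrAC [a + (b - 1)]addrA; ring.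
rewrite -!IHn !mulr_sumr.
have -> : \sum_(i < n.+2) n.+1%:R * (gbinom a i * gbinom b (n.+1 - i)) =
   \sum_(i < n.+2) (i%:R * gbinom a i) * gbinom b (n.+1 - i)
  + \sum_(i < n.+2) gbinom a i * ((n.+1 - i)%:R * gbinom b (n.+1 - i)).
  rewrite -big_split; apply: eq_bigr => i _ /=.
  have le_in : (i <= n.+1)%N by rewrite -ltnS.
  have -> : n.+1%:R = i%:R + (n.+1 - i)%:R :> R by rewrite -natrD subnKC.
  by ring.
congr (_ + _).
  rewrite big_ord_recl mul0r mul0r add0r; apply: eq_bigr => i _.
  by rewrite lift0 lower subSS mulrA.
rewrite big_ord_recr /= subnn mul0r mulr0 addr0; apply: eq_bigr => i _.
by rewrite subSn -1?ltnS // lower; ring.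
Qed.

End Binomials.

(** * Ladder relations, differential equation and top coefficient *)

Section Jacobi.
Variable R : realFieldType.
Implicit Types a b : R.

Let mono n j : {poly R} := ('X - 1) ^+ (n - j) * ('X + 1) ^+ j.

Let deriv_mono n j :
  (mono n j)^`() = (n - j)%:R *: (('X - 1) ^+ (n - j).-1 * ('X + 1) ^+ j)
                   + j%:R *: (('X - 1) ^+ (n - j) * ('X + 1) ^+ j.-1).
Proof.
rewrite /mono derivM !deriv_exp !derivD derivN !derivX -[1]/(1%:P) derivC.
by rewrite !subr0 !addr0 !mul1r !scaler_nat mulrnAl mulrnAr.
Qed.

Let raise_mono n j :
  ('X + 1) * (mono n j)^`() = (n - j)%:R *: mono n j.+1 + j%:R *: mono n j.
Proof.
rewrite deriv_mono mulrDr -!scalerAr; congr (_ + _).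
  by rewrite /mono subnS exprS mulrCA.
by case: j => [|j]; rewrite ?scale0r // /mono [_ ^+ j.+1]exprS mulrCA.
Qed.

Let lower_mono n j : (j <= n)%N ->
  ('X - 1) * (mono n j)^`() = (n - j)%:R *: mono n j + j%:R *: mono n j.-1.
Proof.
move=> jn; rewrite deriv_mono mulrDr -!scalerAr; congr (_ + _).
  rewrite /mono; case: (n - j)%N => [|i]; first by rewrite !scale0r.
  by rewrite [_ ^+ i.+1]exprS -mulrA.
case: j jn => [|j] jn; rewrite ?scale0r // /mono mulrA -exprS.
by rewrite -subSn.
Qed.

(** Half of a factorization of the Jacobi operator, checked coefficientwise on the products
    [(x-1)^(n-j) (x+1)^j], which [(x+1) d] maps to combinations of neighbours. *)
Lemma jacobi_raise a b n :
  ('X + 1) * (jacobi a b n)^`() + b *: jacobi a b n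
   = (n%:R + b) *: jacobi (a + 1) (b - 1) n.
Proof.
rewrite /jacobi derivZ -scalerAr !(scalerA, mulrC _ (2%:R ^- n)).
rewrite -!(scalerA (2%:R ^- n)) -scalerDr; congr (_ *: _).
set A := gbinom _; set B := gbinom _.
pose f j := (A j * B (n - j)%N).
transitivity (\sum_(j < n.+1) ((f j * (n - j)%:R) *: mono n j.+1)
            + \sum_(j < n.+1) ((f j * (b + j%:R)) *: mono n j)).
  rewrite raddf_sum mulr_sumr scaler_sumr -!big_split; apply: eq_bigr => j _ /=.
  rewrite derivZ -scalerAr raise_mono -/(f j) -/(mono n j).
  rewrite scalerDr !scalerA -addrA -scalerDl; congr (_ + _ *: _).
  by rewrite [b * _]mulrC -mulrDr addrC.
rewrite big_ord_recr /= subnn mulr0 scale0r addr0 [X in _ + X]big_ord_recl.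
rewrite addrCA -big_split /= scaler_sumr [RHS]big_ord_recl -!/(mono _ _).
have EB i : (n%:R + b) * gbinom (n%:R + (b - 1)) i = (n%:R + b - i%:R) * B i.
  by have := gbinom_upper (n%:R + (b - 1)) i; rewrite addrA subrK => <-.
congr (_ + _).
  rewrite subn0 scalerA mulrCA EB /f /A !gbinom0 !subn0; congr (_ *: _); ring.
apply: eq_bigr => i _; rewrite !lift0 -scalerDl scalerA; congr (_ *: _).
rewrite [RHS]mulrCA EB addrA gbinom_pascal -/A /f.
have -> : n%:R = (n - i.+1)%:R + i.+1%:R :> R by rewrite -natrD subnK.
have -> : (n - i)%N = (n - i.+1).+1 by rewrite -subSn.
rewrite -[_ * B _ * _]mulrA [B _ * _.+1%:R]mulrC gbinomS -/(B _) /bump /= add1n.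
have -> : n%:R = (n - i.+1)%:R + i.+1%:R :> R by rewrite -natrD subnK.
ring.
Qed.

Lemma jacobi_lower a b n :
  ('X - 1) * (jacobi a b n)^`() + a *: jacobi a b n
   = (n%:R + a) *: jacobi (a - 1) (b + 1) n.
Proof.
rewrite /jacobi derivZ -scalerAr !(scalerA, mulrC _ (2%:R ^- n)).
rewrite -!(scalerA (2%:R ^- n)) -scalerDr; congr (_ *: _).
set A := gbinom _; set B := gbinom _.
pose f j := (A j * B (n - j)%N).
transitivity (\sum_(j < n.+1) ((f j * ((n - j)%:R + a)) *: mono n j)
            + \sum_(j < n.+1) ((f j * j%:R) *: mono n j.-1)).
  rewrite raddf_sum mulr_sumr scaler_sumr -!big_split; apply: eq_bigr => j _ /=.
  rewrite derivZ -scalerAr lower_mono -1?ltnS // -/(f j) -/(mono n j).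
  rewrite scalerDr !scalerA addrAC -scalerDl; congr (_ *: _ + _).
  by rewrite [a * _]mulrC -mulrDr.
rewrite [X in _ + X]big_ord_recl /= mulr0 scale0r add0r [X in X + _]big_ord_recr.
rewrite addrAC -big_split /= scaler_sumr [RHS]big_ord_recr -!/(mono _ _) /=.
have EA i : (n%:R + a) * gbinom (n%:R + (a - 1)) i = (n%:R + a - i%:R) * A i.
  by have := gbinom_upper (n%:R + (a - 1)) i; rewrite addrA subrK => <-.
congr (_ + _).
  apply: eq_bigr => i _; rewrite -scalerDl scalerA; congr (_ *: _).
  rewrite [RHS]mulrA EA addrA /f /=.
  rewrite ?[bump 0 i]add1n.
  have -> : (n - i)%N = (n - i.+1).+1 by rewrite -subSn.
  rewrite gbinom_pascal -/B -[n%:R + a - _]addrAC.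
  rewrite [A i.+1 * _ * _]mulrAC [A i.+1 * _]mulrC gbinomS -/(A _).
  have -> : n%:R = (n - i.+1)%:R + i.+1%:R :> R by rewrite -natrD subnK.
  rewrite -[(n - i.+1).+1%:R]natr1 -[i.+1%:R]natr1; ring.
rewrite subnn scalerA mulrA EA /f subnn /B !gbinom0; congr (_ *: _); ring.
Qed.

(** Raise from [(a, b)] to [(a+1, b-1)], then lower back: eliminating the intermediate polynomial
    gives the second order equation. *)
Lemma jacobi_ode a b n :
  (1 - 'X ^+ 2) * (jacobi a b n)^`(2)
  + ((b - a)%:P - (a + b + 2%:R) *: 'X) * (jacobi a b n)^`()
   = - (n%:R * (n%:R + a + b + 1)) *: jacobi a b n.
Proof.
rewrite derivnS derivn1.
have := jacobi_lower (a + 1) (b - 1) n; rewrite addrK subrK.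
have := jacobi_raise a b n.
move: (jacobi a b n) (jacobi (a + 1) (b - 1) n) => P Q raise.
move=> /(congr1 (GRing.scale (n%:R + b))).
rewrite scalerDr scalerAr -derivZ !scalerA [_ * (a + 1)]mulrC -(scalerA (a + 1)) -raise.
rewrite derivD derivM derivZ derivD derivX -[1]/(1%:P) derivC addr0 mul1r.
rewrite -!mul_polyC !(polyCD, polyCB, polyCN, polyCM) => /eqP.
rewrite -subr_eq0 => /eqP E; apply/eqP; rewrite -subr_eq0 -[X in _ == X]oppr0 -E.
apply/eqP; ring.
Qed.

Let monic_mono n j : (j <= n)%N -> mono n j \is monic /\ size (mono n j) = n.+1.
Proof.
move=> jn; have E : mono n j = ('X - 1%:P) ^+ (n - j) * ('X - (-1)%:P) ^+ j.
  by rewrite polyCN opprK.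
have m1 : ('X - 1%:P) ^+ (n - j) \is @monic R by rewrite monic_exp ?monicXsubC.
have m2 : ('X - (-1)%:P) ^+ j \is @monic R by rewrite monic_exp ?monicXsubC.
rewrite E; split; first by rewrite monicMl.
by rewrite size_monicM ?monic_neq0 // !size_exp_XsubC addnS addSn subnK.
Qed.

Lemma size_jacobi_leq a b n : (size (jacobi a b n) <= n.+1)%N.
Proof.
rewrite /jacobi (leq_trans (size_scale_leq _ _)) //.
apply: (leq_trans (size_sum _ _ _)); apply/bigmax_leqP => j _.
by rewrite (leq_trans (size_scale_leq _ _)) // -/(mono _ _) (monic_mono _).2 // -ltnS.
Qed.

Lemma coef_jacobi_top a b n :
  (jacobi a b n)`_n = 2%:R ^- n * gbinom (n%:R + a + (n%:R + b)) n.
Proof.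
rewrite /jacobi coefZ coef_sum -gbinom_vandermonde; congr (_ * _).
apply: eq_bigr => j _; have [|/monicP m s] := @monic_mono n j; first by rewrite -ltnS.
have mn : (mono n j)`_n = 1 by rewrite -m lead_coefE s.
by rewrite coefZ -/(mono _ _) mn mulr1.
Qed.

Lemma coef_jacobi_top_neq0 a b n : ~ negint (a + b) -> (jacobi a b n)`_n != 0.
Proof.
move=> nab; rewrite coef_jacobi_top mulf_neq0 ?invr_neq0 ?expf_neq0 ?pnatr_eq0 //.
rewrite /gbinom mulf_neq0 ?invr_neq0 ?pnatr_eq0 -?lt0n ?fact_gt0 //.
(* A vanishing factor means [a + b = -(2n - i)] with [i < n], a negative integer. *)
apply/prodf_neq0 => i _; apply/eqP => E; apply: nab; exists (n + (n - i.+1))%N.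
move: E; have -> : (n + (n - i.+1)).+1 = (n + (n - i))%N.
  by rewrite -addnS -subSn.
rewrite natrD natrB 1?ltnW // => E; apply/eqP; rewrite -subr_eq0 opprK -E.
by apply/eqP; ring.
Qed.

End Jacobi.

(** * Derivatives of a polynomial times [(1+x)^(-be)] *)

Section Twist.
Variable R : realFieldType.
Implicit Types (be : R) (Q : {poly R}).

(* [(-1)^j (1+x)^(be+j)] times the [j]-th derivative of [(1+x)^(-be) Q]. *)
Fixpoint twist be j Q : {poly R} :=
  if j is j'.+1 then
    (be + j'%:R) *: twist be j' Q - (1 + 'X) * (twist be j' Q)^`()
  else Q.

(** Each derivative is one use of [jacobi_raise], and its factor [be - f + j] builds up the
    Pochhammer symbol. Hence the [F2] rows are jets. *)
Lemma twist_jacobi al be f j :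
  twist be j (jacobi al (- be) f)
   = poch (be - f%:R) j *: jacobi (al + j%:R) (- be - j%:R) f.
Proof.
elim: j => [|j IHj]; first by rewrite /poch big_ord0 scale1r addr0 subr0.
rewrite /= {}IHj derivZ -scalerAr /poch big_ord_recr /= -/(poch _ _).
have := jacobi_raise (al + j%:R) (- be - j%:R) f.
rewrite ['X + 1]addrC => E.
have -> : al + j.+1%:R = al + j%:R + 1 by rewrite -natr1 addrA.
have -> : - be - j.+1%:R = - be - j%:R - 1 by rewrite -natr1; ring.
rewrite scalerA [_ * poch _ _]mulrC -!(scalerA (poch _ _)) -scalerBr; congr (_ *: _).
have -> : be - f%:R + j%:R = - (f%:R + (- be - j%:R)) by ring.
rewrite scaleNr -E opprD [RHS]addrC -scaleNr; congr (_ *: _ - _); ring.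
Qed.

Lemma twistP be j a p q : twist be j (a *: p + q) = a *: twist be j p + twist be j q.
Proof.
elim: j => //= j ->; rewrite derivD derivZ -!mul_polyC; ring.
Qed.

Lemma twist_dvd be j m Q : (1 + 'X) ^+ m %| Q -> (1 + 'X) ^+ m %| twist be j Q.
Proof.
move=> dQ; elim: j => //= j; set S := twist _ _ _ => /dvdpP [q E].
apply: dvdp_sub; first by rewrite -mul_polyC E mulrA dvdp_mull.
have dX : (1 + 'X : {poly R})^`() = 1 by rewrite derivD derivX -[1]/(1%:P) derivC add0r.
rewrite E derivM mulrDr deriv_exp dX mul1r; apply: dvdp_add.
  by rewrite mulrA dvdp_mull.
case: m {E dQ} => [|m]; first by rewrite dvd1p.
by rewrite mulrCA mulrnAr -exprS dvdp_mull // -scaler_nat dvdpZr ?pnatr_eq0.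
Qed.

End Twist.

(** * Determinants of polynomials *)

Section TopCoefficient.
Variable R : comNzRingType.
Implicit Types (p q : {poly R}).

(** Since [c] may be zero, entries whose degree drops are allowed, and the notion is stable under
    products and determinants. *)
Definition has_top m p (c : R) := (size p <= m.+1)%N /\ p`_m = c.

Lemma has_topM m n p q a b :
  has_top m p a -> has_top n q b -> has_top (m + n) (p * q) (a * b).
Proof.
move=> [sp <-] [sq <-]; split.
  apply: leq_trans (size_polyMleq _ _) _.
  by rewrite -subn1 leq_subLR add1n -addSn -addnS leq_add.
have lm : (m < (m + n).+1)%N by rewrite ltnS leq_addr.
rewrite coefM (bigD1 (Ordinal lm)) //= addKn big1 ?addr0 // => i.
rewrite -val_eqE /= neq_ltn => /orP[lim|lmi].
  by rewrite [q`__]nth_default ?mulr0 // (leq_trans sq) // ltn_subRL ltn_add2r.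
by rewrite [p`__]nth_default ?mul0r // (leq_trans sp).
Qed.

Lemma has_top_det n (A : 'M[{poly R}]_n) (D : 'I_n -> nat) (B : 'M[R]_n) :
    (forall i j, has_top (D i) (A i j) (B i j)) ->
  has_top (\sum_i D i) (\det A) (\det B).
Proof.
move=> AB.
have prodP (s : perm.perm_type 'I_n) :
    has_top (\sum_i D i) (\prod_i A i (perm.fun_of_perm s i))
            (\prod_i B i (perm.fun_of_perm s i)).
  apply: (big_ind3 has_top) => //; last by move=> *; apply: has_topM.
  by split; rewrite ?size_poly1 ?coef1.
split.
  apply: leq_trans (size_sum _ _ _) _; apply/bigmax_leqP => s _.
  by case: (perm.odd_perm s); rewrite ?mulN1r ?size_polyN ?mul1r (prodP s).1.
rewrite coef_sum; apply: eq_bigr => s _; rewrite -(prodP s).2.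
by case: (perm.odd_perm s); rewrite ?mulN1r ?coefN ?mul1r.
Qed.

End TopCoefficient.

Section PochDet.
Variable R : realFieldType.

(** [poch x j] is monic of degree [j] in [x], so the matrix is a Vandermonde matrix times a
    unitriangular one. *)
Lemma det_poch_neq0 n (x : 'I_n -> R) :
  injective x -> \det (\matrix_(i < n, j < n) poch (x i) j) != 0.
Proof.
move=> xinj.
pose Q (j : nat) : {poly R} := \prod_(l < j) ('X - (- l%:R)%:P).
have Qm j : Q j \is monic by rewrite monic_prod // => l _; apply: monicXsubC.
have Qs j : size (Q j) = j.+1 by rewrite size_prod_XsubC /index_enum -enumT size_enum_ord.
pose C := \matrix_(l < n, j < n) (Q j)`_l.
have -> : \matrix_(i < n, j < n) poch (x i) j
   = (Vandermonde n (\row_i x i))^T *m C.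
  apply/matrixP => i j; rewrite !mxE.
  transitivity (Q j).[x i].
    by rewrite horner_prod; apply: eq_bigr => l _; rewrite hornerXsubC opprK.
  rewrite (@horner_coef_wide _ n) ?Qs //; apply: eq_bigr => l _.
  by rewrite !mxE mulrC.
rewrite det_mulmx det_tr det_Vandermonde mulf_neq0 //.
  apply/prodf_neq0 => i _; apply/prodf_neq0 => j ij.
  rewrite !mxE subr_eq0; apply/eqP => /xinj ji.
  by rewrite ji ltnn in ij.
rewrite -det_tr det_trig; last first.
  by apply/is_trig_mxP => i j ij; rewrite !mxE nth_default ?Qs.
apply/prodf_neq0 => i _; rewrite !mxE.
by have /monicP := Qm i; rewrite lead_coefE Qs /= => ->; rewrite oner_neq0.
Qed.

End PochDet.

Lemma sum_uniq_geq_bin (s : seq nat) :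
  uniq s -> ('C(size s, 2) <= \sum_(x <- s) x)%N.
Proof.
move=> us; rewrite -(perm_big _ (permEl (perm_sort leq s))) /= -(size_sort leq s).
have : sorted ltn (sort leq s) by rewrite sort_lt_sorted.
move: (sort leq s) => {us}s /(sortedP 0%N) ss.
rewrite -bin2_sum [in leqRHS](big_nth 0%N) big_nat [in leqRHS]big_nat.
apply: leq_sum => i /andP[_].
by elim: i => // i IHi lt_is; apply: leq_ltn_trans (IHi (ltnW lt_is)) (ss _ lt_is).
Qed.

(** * Divisibility of the determinants by powers of [1+x] *)

Section Echelon.
Variable R : realFieldType.

Lemma dvdp_Xn_coef (p : {poly R}) n :
  (forall i, (i < n)%N -> p`_i = 0) -> 'X^n %| p.
Proof.
move=> p0; rewrite -(poly_take_drop n p); suff -> : take_poly n p = 0.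
  by rewrite add0r dvdp_mull.
by apply/polyP => i; rewrite coef_take_poly coef0; case: ifP => // /p0.
Qed.

(** An LUP decomposition of the matrix of Taylor coefficients at [-1] makes it upper triangular
    after an invertible change of the family; row [l] of the triangular factor starts at order
    [l]. *)
Lemma echelon m (Q : 'I_m -> {poly R}) :
  exists (G : 'M[R]_m) (S : 'I_m -> {poly R}),
    (forall i, Q i = \sum_l G i l *: S l) /\ (forall l : 'I_m, (1 + 'X) ^+ l %| S l).
Proof.
case: m Q => [|m] Q; first by exists 0, Q; split; case.
pose q i := Q i \Po ('X - 1); pose C : 'M[R]_m.+1 := \matrix_(i, l) (q i)`_l.
have := cormen_lup_perm C; have := cormen_lup_correct C.
have := cormen_lup_detL C; have := @cormen_lup_upper _ _ C.
case: (cormen_lup C) => [[P L] U] /= Uup detL PC /is_perm_mxP[s Ps].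
have Pu : P \in unitmx by rewrite Ps unitmx_perm.
have Lu : L \in unitmx by rewrite unitmxE detL unitr1.
pose G := invmx P *m L; have Gu : G \in unitmx by rewrite unitmx_mul unitmx_inv Pu.
have GU : invmx G *m C = U.
  apply: (canLR (mulKmx Gu)); rewrite -mulmxA -[L *m U]PC mulKmx //.
pose S l := \sum_i invmx G l i *: Q i.
exists G, S; split=> [i|l].
  rewrite /S; under eq_bigr do rewrite scaler_sumr.
  rewrite exchange_big /=.
  under eq_bigr => j _ do (under eq_bigr do rewrite scalerA; rewrite -scaler_suml).
  have E j : \sum_l G i l * invmx G l j = (i == j)%:R.
    by have /matrixP/(_ i j) := mulmxV Gu; rewrite !mxE.
  under eq_bigr do rewrite E.
  rewrite (bigD1 i) //= eqxx scale1r big1 ?addr0 // => j.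
  by rewrite eq_sym => /negPf ->; rewrite scale0r.
have -> : S l = (S l \Po ('X - 1)) \Po ('X + 1).
  by rewrite -comp_polyA rmorphB rmorph1 /= comp_polyX addrK comp_polyXr.
have -> : (1 + 'X) ^+ l = 'X^l \Po ('X + 1) :> {poly R} by rewrite comp_Xn_poly addrC.
apply: dvdp_comp_poly; apply: dvdp_Xn_coef => i il.
have im : (i < m.+1)%N by apply: ltn_trans (ltn_ord l).
have U0 : U l (Ordinal im) = 0 by apply: Uup.
rewrite -[RHS]U0 -GU mxE /S [in LHS]linear_sum coef_sum; apply: eq_bigr => j _.
by rewrite linearZ coefZ [C _ _]mxE.
Qed.

Lemma dvdp_prod (I : finType) (F G : I -> {poly R}) :
  (forall i, F i %| G i) -> \prod_i F i %| \prod_i G i.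
Proof. by move=> FG; apply: (big_ind2 (fun p q => p %| q)) => *; rewrite ?dvdpp ?dvdp_mul. Qed.

(** After passing to the echelon family, in every term of the permutation expansion row [l]
    contributes [(1+x)^(e_l + l)] with distinct [e_l]. Both [e_l] and [l] sum to at least [C(k,2)],
    in total [k(k-1)]. *)
Lemma det_twist_dvd be m k (A : 'M[{poly R}]_(m + k)) (Q : 'I_k -> {poly R}) :
    (forall i j, A (rshift m i) j = (1 + 'X) ^+ ((m + k).-1 - j) * twist be j (Q i)) ->
  (1 + 'X) ^+ (k * k.-1) %| \det A.
Proof.
move=> AE; have [G [S [QE Sdvd]]] := echelon Q.
pose B : 'M_(k, m + k) := \matrix_(l, j) ((1 + 'X) ^+ ((m + k).-1 - j) * twist be j (S l)).
have -> : A = block_mx 1%:M 0 0 (map_mx polyC G) *m col_mx (usubmx A) B.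
  rewrite mul_block_col mul1mx !mul0mx addr0 add0r -[LHS]vsubmxK; congr col_mx.
  apply/matrixP => i j; rewrite !mxE AE QE.
  under [RHS]eq_bigr do rewrite !mxE mul_polyC scalerAr.
  rewrite -mulr_sumr; congr (_ * _).
  elim/big_rec2: _ => [|l p q _ <-]; last by rewrite twistP.
  apply: (addrI (twist be j 0)).
  by rewrite addr0 -{1}[twist be j 0]scale1r -twistP scale1r addr0.
rewrite det_mulmx dvdp_mull //.
rewrite /determinant.
apply: (big_ind (fun p : {poly R} => _ %| p)) => [|p q dp dq|s _].
- exact: dvdp0.
- exact: dvdp_add.
apply: dvdp_mull; rewrite big_split_ord /= dvdp_mull //.
pose e l := ((m + k).-1 - perm.fun_of_perm s (rshift m l))%N.
apply: (@dvdp_trans _ (\prod_(l < k) (1 + 'X) ^+ (e l + l))); last first.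
  apply: dvdp_prod => l; rewrite col_mxEd mxE exprD dvdp_mul //.
  exact: twist_dvd.
rewrite prodrXr dvdp_exp2l // big_split /=.
have -> : (k * k.-1 = 'C(k, 2) + 'C(k, 2))%N.
  by rewrite addnn -muln2 -[2%N in RHS]/(2`!) bin_ffact ffactnS ffactn1.
rewrite leq_add // -?triangular_sum ?bin2_sum //; last first.
  by rewrite -[X in (X <= _)%N]bin2_sum big_mkord.
have := @sum_uniq_geq_bin [seq e l | l <- enum 'I_k].
rewrite size_map size_enum_ord big_map big_enum /=; apply.
rewrite map_inj_uniq ?enum_uniq // => l l' /eqP.
have lt x : (perm.fun_of_perm s x <= (m + k).-1)%N.
  by rewrite -ltnS prednK // (leq_ltn_trans _ (ltn_ord x)).
by rewrite /e eqn_sub2lE // => /eqP /val_inj /perm.perm_inj /rshift_inj.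
Qed.

End Echelon.

(** * The derivation of the field of rational functions *)

Section QuotientRule.
Variables (K : fieldType) (p q r s dp dq dr ds : K).
Hypotheses (q0 : q != 0) (s0 : s != 0).

Lemma quotient_ruleB :
  ((dp * s + p * ds - (dr * q + r * dq)) * (q * s)
    - (p * s - r * q) * (dq * s + q * ds)) / (q * s) ^+ 2
  = (dp * q - p * dq) / q ^+ 2 - (dr * s - r * ds) / s ^+ 2.
Proof. by field; rewrite q0 s0. Qed.

Lemma quotient_ruleM :
  ((dp * r + p * dr) * (q * s) - (p * r) * (dq * s + q * ds)) / (q * s) ^+ 2
  = (dp * q - p * dq) / q ^+ 2 * (r / s) + p / q * ((dr * s - r * ds) / s ^+ 2).
Proof. by field; rewrite s0 q0. Qed.

End QuotientRule.

Section FractionDerivation.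
Variable R : fieldType.
Local Notation K := {fraction {poly R}}.
Local Notation "p %:F" := (@FracField.tofrac {poly R} p).

Lemma frac_repr (x : K) : x = (\n_(repr x))%:F / (\d_(repr x))%:F.
Proof.
have d0 : (\d_(repr x))%:F != 0 :> K by rewrite tofrac_eq0 denom_ratioP.
apply: (canRL (mulfK d0)); rewrite -{1}[x]reprK; unlock FracField.tofrac.
rewrite -[LHS]FracField.pi_mul; apply/eqmodP.
rewrite /= FracField.equivfE /FracField.mulf !numden_Ratio;
  rewrite ?(oner_neq0, mulf_neq0) ?denom_ratioP //.
by rewrite !mulr1 mulrC.
Qed.

Lemma frac_ind (P : K -> Prop) :
  (forall p q : {poly R}, q != 0 -> P (p%:F / q%:F)) -> forall x, P x.
Proof. by move=> Pf x; rewrite [x]frac_repr; apply: Pf; apply: denom_ratioP. Qed.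

(** Independence of the chosen representative, needed for [frac_deriv]. The cross-multiplied
    difference is the numerator of the derivative of [(p e - n q)/(e q)], where [p e - n q = 0]. *)
Lemma quotient_rule_wd (p q n e : {poly R}) : q != 0 -> e != 0 ->
    p%:F / q%:F = n%:F / e%:F :> K ->
  (p^`() * q - p * q^`())%:F / (q ^+ 2)%:F
    = (n^`() * e - n * e^`())%:F / (e ^+ 2)%:F :> K.
Proof.
have F0 (u : {poly R}) : u != 0 -> u%:F != 0 :> K by rewrite tofrac_eq0.
move=> q0 e0 /(congr1 (fun z => z * q%:F * e%:F)).
rewrite divfK ?F0 // mulrAC divfK ?F0 // => EF.
have {EF} E : p * e = n * q by apply/eqP; rewrite -tofrac_eq !tofracM EF.
have /eqP := congr1 (@deriv R) E; rewrite !derivM -subr_eq0 => /eqP E'.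
have /eqP := E; rewrite -subr_eq0 => /eqP {}E.
have D0 : (p^`() * q - p * q^`()) * e ^+ 2 = (n^`() * e - n * e^`()) * q ^+ 2.
  apply/eqP; rewrite -subr_eq0; apply/eqP.
  transitivity ((p^`() * e + p * e^`() - (n^`() * q + n * q^`())) * (e * q)
     - (p * e - n * q) * (e * q^`() + e^`() * q)); first by ring.
  by rewrite E E' !mul0r subr0.
have F2 (u : {poly R}) : u != 0 -> (u ^+ 2)%:F != 0 :> K.
  by move=> u0; rewrite F0 ?expf_neq0.
apply: (mulIf (F2 _ e0)); rewrite divfK ?F2 // mulrAC -tofracM D0 tofracM.
by rewrite mulfK ?F2.
Qed.

Definition frac_deriv (x : K) : K :=
  let p := \n_(repr x) in let q := \d_(repr x) in
  (p^`() * q - p * q^`())%:F / (q ^+ 2)%:F.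

Lemma frac_derivE (p q : {poly R}) : q != 0 ->
  frac_deriv (p%:F / q%:F) = (p^`() * q - p * q^`())%:F / (q ^+ 2)%:F.
Proof.
move=> q0; apply: quotient_rule_wd => //; first exact: denom_ratioP.
by rewrite -frac_repr.
Qed.

Lemma frac_deriv_poly (p : {poly R}) : frac_deriv p%:F = p^`()%:F.
Proof.
have := @frac_derivE p 1 (oner_neq0 _).
by rewrite -[1]/(1%:P) derivC mulr0 subr0 expr1n tofrac1 !divr1 mulr1.
Qed.

Fact frac_deriv_is_zmod_morphism : zmod_morphism frac_deriv.
Proof.
elim/frac_ind => p q q0; elim/frac_ind => r s s0.
have F0 (u : {poly R}) : u != 0 -> u%:F != 0 :> K by rewrite tofrac_eq0.
rewrite -mulNr addf_div ?F0 // mulNr -!tofracM -tofracB.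
rewrite !frac_derivE ?mulf_neq0 // derivB !derivM.
rewrite !(tofracB, tofracD, tofracM, tofracXn).
by apply: quotient_ruleB; apply: F0.
Qed.

HB.instance Definition _ :=
  GRing.isZmodMorphism.Build K K frac_deriv frac_deriv_is_zmod_morphism.

Lemma frac_derivM x y : frac_deriv (x * y) = frac_deriv x * y + x * frac_deriv y.
Proof.
elim/frac_ind: x => p q q0; elim/frac_ind: y => r s s0.
have F0 (u : {poly R}) : u != 0 -> u%:F != 0 :> K by rewrite tofrac_eq0.
rewrite mulf_div -!tofracM !frac_derivE ?mulf_neq0 // !derivM.
rewrite !(tofracB, tofracD, tofracM, tofracXn).
by apply: quotient_ruleM; apply: F0.
Qed.

End FractionDerivation.

(** * Crum's transform of the Jacobi operator *)

Section Gauge.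
Variables (K : fieldType) (d : {additive K -> K}).
Hypothesis dM : forall x y, d (x * y) = d x * y + x * d y.

Lemma deriv_div x y : y != 0 -> d (x / y) = d x / y - x * d y / y ^+ 2.
Proof. by move=> y0; rewrite dM deriv_inv //; field. Qed.

Lemma deriv_expn x n : x != 0 -> d (x ^+ n) = n%:R * x ^+ n * d x / x.
Proof.
move=> x0; elim: n => [|n IHn]; first by rewrite deriv_one // !mul0r.
by rewrite exprS dM IHn -[n.+1%:R]natr1; field.
Qed.

(** Here [h] is [(1+x)^(-k2)], entering only through its logarithmic derivative. Substituting
    [z = P h / Om] and clearing denominators gives an equation bilinear in [P] and [Om]. *)
Lemma crum_gauge (x al be Om P z tau mu h : K) (k1 k2 : nat) :
    d x = 1 -> d al = 0 -> d be = 0 -> 1 + x != 0 -> Om != 0 -> h != 0 ->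
    d h = - (k2%:R * h / (1 + x)) ->
    z = P * h / Om ->
    tau = k2%:R * (k1%:R + be) / (1 + x) - d Om / Om ->
    let p := 1 - x ^+ 2 in let q := be - al - (al + be + 2) * x in
    p * d (d z) + crum_q d p q (k1 + k2) * d z
      + crum_r d p q (k1 + k2) tau * z = mu * z ->
  (1 - x ^+ 2) * (d (d P) * Om - 2 * d P * d Om + P * d (d Om))
  + (be - al - 2 * k2%:R - (al + be + 2 * k1%:R + 2) * x) * (d P * Om)
  + (al - be + 2 * k2%:R + (2 * k1%:R + al + be) * x) * (P * d Om)
  - k1%:R * (k1%:R + al + be + 1) * (P * Om) = mu * (P * Om).
Proof.
move=> dx dal dbe t0 Om0 h0 dh zE tauE p q.
have d1 := deriv_one dM; have dn := deriv_nat dM.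
have dt : d (1 + x) = 1 by rewrite raddfD d1 dx add0r.
have dp : d p = - (2 * x) by rewrite raddfB d1 expr2 dM dx; ring.
have ddp : d (d p) = - 2 by rewrite dp raddfN dM dn dx; ring.
have dq : d q = - (al + be + 2).
  by rewrite /q !raddfB /= dM dx !(raddfD d) dal dbe d1; ring.
(* [-e] is the logarithmic derivative of the gauge factor [h / Om]. *)
pose e := k2%:R / (1 + x) + d Om / Om.
have de : d e = - k2%:R / (1 + x) ^+ 2 + d (d Om) / Om - (d Om / Om) ^+ 2.
  by rewrite raddfD /= !deriv_div // dn dt; field; rewrite Om0.
have dg : d (h / Om) = - (h / Om * e).
  by rewrite deriv_div // dh /e; field; rewrite Om0.
have ddg : d (d (h / Om)) = h / Om * (e ^+ 2 - d e).
  by rewrite dg raddfN dM dg; ring.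
have zg : z = P * (h / Om) by rewrite zE mulrA.
have dz : d z = (d P - P * e) * (h / Om) by rewrite zg dM dg; ring.
have ddz : d (d z) = (d (d P) - 2 * d P * e + P * (e ^+ 2 - d e)) * (h / Om).
  by rewrite dz dM dg raddfB /= dM; ring.
have dtau : d tau = - k2%:R * (k1%:R + be) / (1 + x) ^+ 2
                    - d (d Om) / Om + (d Om / Om) ^+ 2.
  rewrite tauE raddfB /= !deriv_div // dM raddfD !dn dbe dt.
  by field; rewrite Om0.
(* The binomial in [crum_r] multiplies [p'' = -2], so its double suffices. *)
have bin : 'C(k1 + k2, 2)%:R * 2 = (k1%:R + k2%:R) * (k1%:R + k2%:R - 1) :> K.
  rewrite -natrM -[2%N in LHS]/(2`!) bin_ffact ffactnS ffactn1 natrM natrD.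
  by case: (k1 + k2)%N (natrD K k1 k2) => [|n] <-; rewrite ?mul0r // -natr1 addrK.
rewrite /crum_q /crum_r ddz dz zg ddp dp dq de dtau tauE natrD.
have -> : 'C(k1 + k2, 2)%:R * - 2 = - ((k1%:R + k2%:R) * (k1%:R + k2%:R - 1)) :> K.
  by rewrite mulrN bin.
rewrite /e /p /q => H.
have h1 : h / Om != 0 by rewrite mulf_neq0 ?invr_eq0.
apply: (mulIf h1); rewrite -[RHS]mulrA [P * Om * _]mulrAC [RHS]mulrA -H.
by field; rewrite Om0.
Qed.

Lemma log_deriv_wronskian (t s W tau y Om : K) (n : nat) :
    d t = 1 -> d s = 0 -> t != 0 -> Om != 0 -> Om = t ^+ n * s * W ->
    d W = - (tau + y) * W ->
  tau = n%:R / t - y - d Om / Om.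
Proof.
move=> dt ds t0 Om0 OmE dW.
have -> : d Om = Om * (n%:R / t - (tau + y)).
  rewrite {1}OmE !dM ds dW deriv_expn // dt OmE; field; exact: t0.
by field; rewrite Om0.
Qed.

(* Conjugating by [(1+x)^be] turns the Jacobi operator with parameters
   [(al, be)] into the one with parameters [(al, - be)], up to a constant. *)
Lemma twisted_eigen (x al be lam J : K) :
    d x = 1 -> d be = 0 -> 1 + x != 0 ->
    (1 - x ^+ 2) * d (d J) + (- be - al - (al + - be + 2) * x) * d J = lam * J ->
  let nabla w := d w + - (be / (1 + x)) * w in
  (1 - x ^+ 2) * nabla (nabla J) + (be - al - (al + be + 2) * x) * nabla J
   = (lam + be * (1 + al)) * J.
Proof.
move=> dx dbe t0 H nabla; rewrite [RHS]mulrDl -H /nabla.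
have dt : d (1 + x) = 1 by rewrite raddfD deriv_one // dx add0r.
rewrite raddfD /= dM raddfN /= deriv_div // dbe dt; field.
exact: t0.
Qed.

Lemma twisted_jet_step (t s be S : K) j :
    d t = 1 -> d s = 0 -> t != 0 ->
  d (s * S / t ^+ j) + - (be / t) * (s * S / t ^+ j)
   = - s * ((be + j%:R) * S - t * d S) / t ^+ j.+1.
Proof.
move=> dt ds t0; rewrite deriv_div ?expf_neq0 // dM ds deriv_expn // dt [t ^+ j.+1]exprS.
by field; rewrite t0 expf_neq0.
Qed.

End Gauge.

(** * The matrix rows as jets of eigenfunctions *)

Section Exceptional.
Variables (R : realFieldType) (al be : R) (F1 F2 : seq nat).
Local Notation k1 := (size F1).
Local Notation k2 := (size F2).
Local Notation K := {fraction {poly R}}.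
Local Notation "p %:F" := (@FracField.tofrac {poly R} p).
Local Notation D := (@frac_deriv R : {additive K -> K}).

Let DM : forall x y, D (x * y) = D x * y + x * D y := @frac_derivM R.
Let DP : forall p : {poly R}, D p%:F = p^`()%:F := @frac_deriv_poly R.

Definition index_at m i : nat := nth 0%N (m :: F1 ++ F2) i.

(** One family of rows for both matrices: [Mmat] takes all rows with [e = k], [Wmat] the rows from 1
    on with [e = k-1]. *)
Definition jacobi_row m e i j : {poly R} :=
  if (k1 < i)%N then rowF2 al be (index_at m i) j (e - j)
  else rowF1 al be (index_at m i) j.

Lemma MmatE n :
  Mmat al be F1 F2 n
  = \matrix_(i, j) jacobi_row (n - uF F1 F2) (k1 + k2) i j.
Proof.
apply/matrixP => i j; rewrite !mxE /jacobi_row /index_at.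
case: (nat_of_ord i) => [|i'] //=.
by rewrite nth_cat ltnS [in RHS]ltnNge; case: ltnP.
Qed.

Lemma WmatE m :
  Wmat al be F1 F2 = \matrix_(i, j) jacobi_row m (k1 + k2).-1 i.+1 j.
Proof.
apply/matrixP => i j; rewrite !mxE /jacobi_row /index_at /=.
by rewrite nth_cat ltnS [in RHS]ltnNge subnS -predn_sub; case: ltnP.
Qed.

Definition seed m i : {poly R} :=
  jacobi al (if (k1 < i)%N then - be else be) (index_at m i).

Definition cst (a : R) : K := a%:P%:F.

Lemma cstD a b : cst (a + b) = cst a + cst b.
Proof. by rewrite /cst polyCD tofracD. Qed.

Lemma cstM a b : cst (a * b) = cst a * cst b.
Proof. by rewrite /cst polyCM tofracM. Qed.

Lemma cstN a : cst (- a) = - cst a.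
Proof. by rewrite /cst polyCN tofracN. Qed.

Lemma cst_nat n : cst n%:R = n%:R.
Proof. by rewrite /cst polyC_natr; apply: rmorph_nat. Qed.

Lemma cst1 : cst 1 = 1.
Proof. exact: (cst_nat 1). Qed.

Let cstE := (cstD, cstM, cstN, cst_nat, cst1).

Lemma deriv_cst a : D (cst a) = 0.
Proof. by rewrite DP derivC tofrac0. Qed.

Definition xK : K := 'X%:F.

Lemma deriv_xK : D xK = 1.
Proof. by rewrite DP derivX tofrac1. Qed.

Lemma tE : (1 + 'X)%:F = 1 + xK.
Proof. by rewrite tofracD tofrac1. Qed.

Lemma t_neq0 : 1 + xK != 0.
Proof. by rewrite -tE tofrac_eq0 addrC -[1]/(1%:P) monic_neq0 // monicXaddC. Qed.

(** The logarithmic derivative of [(1+x)^(-be)], on the [F2] rows only. *)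
Definition twist_c i : K := if (k1 < i)%N then - (cst be / (1 + xK)) else 0.

Lemma iter_conn_seed m n (i : 'I_n) j :
  iter j (conn D (fun i : 'I_n => twist_c i)) (\col_i (seed m i)%:F) i 0
  = if (k1 < i)%N then (-1) ^+ j * (twist be j (seed m i))%:F / (1 + xK) ^+ j
    else (seed m i)^`(j)%:F.
Proof.
have t0 := t_neq0.
have dt : D (1 + xK) = 1 by rewrite raddfD deriv_one // deriv_xK add0r.
elim: j => [|j IHj]; first by rewrite !mxE /= expr0 mul1r divr1; case: ifP.
rewrite iterS mxE IHj /twist_c; case: ifP => _.
  have ds : D ((-1) ^+ j) = 0.
    by rewrite -signr_odd; case: (odd j); rewrite ?expr0 ?expr1 ?raddfN ?deriv_one ?oppr0.
  rewrite (twisted_jet_step DM) // DP; congr (_ * _ / _); first by rewrite exprS mulN1r.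
  by rewrite /= tofracB -mul_polyC !tofracM tE -/(cst _) !cstE.
by rewrite mul0r addr0 DP -derivnS.
Qed.

(** Writing [(1+x)^(e-j)] as [(1+x)^e / (1+x)^j] splits an entry into a row weight, a column sign
    and a jet, so weights and signs leave the determinant. *)
Lemma jacobi_row_frac m e n (i : 'I_n) j : (j <= e)%N ->
  (jacobi_row m e i j)%:F
  = (if (k1 < i)%N then (1 + xK) ^+ e else 1) * (-1) ^+ j
    * iter j (conn D (fun i : 'I_n => twist_c i)) (\col_i (seed m i)%:F) i 0.
Proof.
move=> je; rewrite iter_conn_seed /jacobi_row /seed; case: ifP => _.
  rewrite /rowF2 scalerAr -twist_jacobi tofracM tofracXn tE.
  rewrite -[in RHS](subnK je) exprD; set T := tofrac _.
  have gen (L : fieldType) (u v s w : L) :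
      v != 0 -> s * s = 1 -> u * w = u * v * s * (s * w / v).
    by move=> v0 ss; rewrite -[LHS]mul1r -ss; field.
  apply: gen; first by rewrite expf_neq0 ?t_neq0.
  by rewrite -exprMn mulrNN mul1r expr1n.
rewrite /rowF1 mul1r -mul_polyC tofracM; congr (_ * _).
by rewrite polyC_exp polyCN tofracXn tofracN tofrac1.
Qed.

Definition pK : K := 1 - xK ^+ 2.
Definition qK : K := cst be - cst al - (cst al + cst be + 2) * xK.

Definition eigen m i : K :=
  let f := (index_at m i)%:R in
  if (k1 < i)%N then - (f * (f + cst al + - cst be + 1)) + cst be * (1 + cst al)
  else - (f * (f + cst al + cst be + 1)).

Lemma deriv_eigen m i : D (eigen m i) = 0.
Proof.
have -> : eigen m i = cst (let f := (index_at m i)%:R in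
   if (k1 < i)%N then - (f * (f + al + - be + 1)) + be * (1 + al)
   else - (f * (f + al + be + 1))).
  by rewrite /eigen; case: ifP => _; rewrite /= !cstE.
exact: deriv_cst.
Qed.

Lemma jacobi_ode_frac b n :
  pK * D (D (jacobi al b n)%:F)
  + (cst b - cst al - (cst al + cst b + 2) * xK) * D (jacobi al b n)%:F
  = - (n%:R * (n%:R + cst al + cst b + 1)) * (jacobi al b n)%:F.
Proof.
have := congr1 (@FracField.tofrac {poly R}) (jacobi_ode al b n).
rewrite -!mul_polyC !(tofracD, tofracM, tofracB) !DP -/(cst _) !cstE.
rewrite -!/(cst _) tofracN tofracXn tofracN tofracM -!/(cst _) !cstE.
exact.
Qed.

Lemma seed_eigen m n :
  let c := fun i : 'I_n => twist_c i in
  act (conn D c) (second_order pK qK) (\col_i (seed m i)%:F)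
  = scale_rows (fun i : 'I_n => eigen m i) (\col_i (seed m i)%:F).
Proof.
rewrite /= act_second_order; apply/matrixP => i j; rewrite ord1 !mxE /twist_c /eigen /seed.
case: ifP => _; last by rewrite !mul0r !addr0 jacobi_ode_frac.
apply: (twisted_eigen DM); rewrite ?t_neq0 ?deriv_xK ?deriv_cst //.
have := jacobi_ode_frac (- be) (index_at m i); by rewrite [cst (- be)]cstE.
Qed.

End Exceptional.

Lemma det_scale_rows_cols (R : comNzRingType) n (a b : 'I_n -> R) (A : 'M[R]_n) :
  \det (\matrix_(i, j) (a i * b j * A i j)) = (\prod_i a i) * (\prod_j b j) * \det A.
Proof.
have -> : \matrix_(i, j) (a i * b j * A i j)
    = diag_mx (\row_i a i) *m A *m diag_mx (\row_j b j).
  apply/matrixP => i j; rewrite mul_mx_diag mul_diag_mx !mxE; ring.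
rewrite !det_mulmx !det_diag mulrAC; congr (_ * _ * _); apply: eq_bigr => i _; exact: mxE.
Qed.

Lemma big_tail (T : Type) (idx : T) (op : Monoid.law idx) k k1 k2 a :
    k = (k1 + k2)%N ->
  \big[op/idx]_(i < k) (if (k1 < i.+1)%N then a else idx) = iter k2 (op a) idx.
Proof.
move=> ->; rewrite big_split_ord /= big1 => [|i _]; last by rewrite ltnS leqNgt ltn_ord.
rewrite Monoid.mul1m -[in RHS](card_ord k2) -big_const; apply: eq_bigr => i _.
by rewrite ltnS leq_addr.
Qed.

(** * From Wronskians to the bilinear equation *)

Section Bilinear.
Variables (R : realFieldType) (al be : R) (F1 F2 : seq nat).
Local Notation k1 := (size F1).
Local Notation k2 := (size F2).
Local Notation K := {fraction {poly R}}.
Local Notation "p %:F" := (@FracField.tofrac {poly R} p).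
Local Notation D := (@frac_deriv R : {additive K -> K}).
Local Notation row := (jacobi_row al be F1 F2).
Local Notation x := (xK R).

Let DM : forall x y, D (x * y) = D x * y + x * D y := @frac_derivM R.
Let DP : forall p : {poly R}, D p%:F = p^`()%:F := @frac_deriv_poly R.

(** Pulling weights and signs out of both determinants gives [Om = (1+x)^(k1 k2) s W] and
    [P = (1+x)^k2 z Om]; the formula for [tau] is then Liouville's. *)
Lemma crum_jacobi k m (P Om : {poly R}) :
    k = (k1 + k2)%N -> (0 < k)%N ->
    \det (\matrix_(i < k.+1, j < k.+1) row m k i j) = P * (1 + 'X) ^+ (k2 * k2.-1) ->
    \det (\matrix_(i < k, j < k) row m k.-1 i.+1 j) = Om * (1 + 'X) ^+ (k2 * k2.-1) ->
    Om != 0 ->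
  exists z tau : K, [/\ z = P%:F * ((1 + x) ^+ k2)^-1 / Om%:F,
    tau = k2%:R * (k1%:R + cst be) / (1 + x) - D Om%:F / Om%:F &
    pK R * D (D z) + crum_q D (pK R) (qK al be) k * D z
      + crum_r D (pK R) (qK al be) k tau * z
     = - (m%:R * (m%:R + cst al + cst be + 1)) * z].
Proof.
move=> kE k0 detM detW Om0; have t0 := t_neq0 R.
have dt : D (1 + x) = 1 by rewrite raddfD deriv_one // deriv_xK add0r.
have OmF0 : Om%:F != 0 by rewrite tofrac_eq0.
case: k kE k0 detM detW => // k' kE _ detM detW.
pose c := fun i : 'I_k'.+2 => twist_c be F1 i.
pose v : 'cV[K]_k'.+2 := \col_i (seed al be F1 F2 m i)%:F.
pose V := row' ord0 (jets D c v k'.+1).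
pose s : K := \prod_(j < k'.+1) (-1) ^+ j.
have ss : s * s = 1.
  rewrite -big_split big1 // => j _ /=.
  by rewrite -exprMn mulrNN mul1r expr1n.
have ds : D s = 0.
  rewrite /s; elim/big_ind: _ => [|a b da db|j _]; first exact: deriv_one.
    by rewrite DM da db mul0r mulr0 addr0.
  by rewrite -signr_odd; case: (odd j); rewrite ?expr0 ?expr1 ?raddfN deriv_one ?oppr0.
have powE k e : k = (k1 + k2)%N ->
    \prod_(i < k) (if (k1 < i.+1)%N then (1 + x) ^+ e else 1) = (1 + x) ^+ (e * k2).
  by move=> kk; rewrite (big_tail _ _ kk) iter_mulr_1 exprM.
have tN e : (1 + x) ^+ e = ((1 + 'X) ^+ e)%:F by rewrite tofracXn tE.
have EW : Om%:F * (1 + x) ^+ (k2 * k2.-1) = (1 + x) ^+ (k' * k2) * s * \det V.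
  rewrite [_ ^+ (k2 * k2.-1)]tN -tofracM -detW -det_map_mx -(powE _ _ kE) -det_scale_rows_cols.
  congr (\det _); apply/matrixP => i j; rewrite !mxE /=.
  by rewrite -(lift0 i) jacobi_row_frac // -ltnS.
have EM : P%:F * (1 + x) ^+ (k2 * k2.-1)
    = (1 + x) ^+ (k'.+1 * k2) * (s * (-1) ^+ k'.+1) * \det (jets D c v k'.+2).
  have -> : (1 + x) ^+ (k'.+1 * k2)
      = \prod_(i < k'.+2) (if (k1 < i)%N then (1 + x) ^+ k'.+1 else 1).
    by rewrite big_ord_recl mul1r -(powE _ _ kE).
  have -> : s * (-1) ^+ k'.+1 = \prod_(j < k'.+2) (-1) ^+ j by rewrite [RHS]big_ord_recr.
  rewrite [_ ^+ (k2 * k2.-1)]tN -tofracM -detM -det_map_mx -det_scale_rows_cols.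
  congr (\det _); apply/matrixP => i j; rewrite !mxE /=.
  by rewrite jacobi_row_frac // -ltnS.
(* Here [k' = k1 + k2 - 1]; this compares the row weights of the Wronskian with the divisor
   [(1+x)^(k2(k2-1))]. *)
have NE : (k' * k2 = k2 * k2.-1 + k1 * k2)%N by move: kE; case: (k2) => [|n]; nia.
have tN0 n : (1 + x) ^+ n != 0 by rewrite expf_eq0 negb_and t0 orbT.
have {}EW : Om%:F = (1 + x) ^+ (k1 * k2) * s * \det V.
  by apply: (mulIf (tN0 (k2 * k2.-1)%N)); rewrite EW NE exprD; ring.
have W0 : \det V != 0 by apply: contraNneq OmF0 => W0; rewrite EW W0 mulr0.
have c0 : c ord0 = 0 by [].
have [z [tau [zeq dW EJ]]] := crum_wronskian DM c0 (fun i => deriv_eigen _ _ _ _ m i)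
  (seed_eigen al be F1 F2 m _) W0.
exists z, tau; split; last exact: zeq.
  have {}EM : P%:F = (1 + x) ^+ k2 * z * Om%:F.
    apply: (mulIf (tN0 (k2 * k2.-1)%N)); rewrite EM EJ EW mulSn NE !exprD.
    have sg : (-1) ^+ k'.+1 * (-1) ^+ k'.+1 = 1 :> K by rewrite -exprMn mulrNN mul1r expr1n.
    transitivity (((-1) ^+ k'.+1 * (-1) ^+ k'.+1) * ((1 + x) ^+ k2
        * ((1 + x) ^+ (k2 * k2.-1) * (1 + x) ^+ (k1 * k2)) * s * z * \det V)).
      by ring.
    by rewrite sg; ring.
  have gen (L : fieldType) (a b e : L) : a != 0 -> e != 0 -> b = a * b * e / a / e.
    by move=> a0 e0; field; rewrite a0 e0.
  rewrite EM; exact: (gen _ _ _ _ (tN0 k2) OmF0).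
have -> := log_deriv_wronskian DM dt ds t0 OmF0 EW dW.
rewrite (big_tail _ _ kE) iter_addr_0.
have gen (L : fieldType) (u w e : L) (a b : nat) :
  (a * b)%:R / w - - (u / w) *+ b - e = b%:R * (a%:R + u) / w - e by ring.
exact: gen.
Qed.

End Bilinear.

Section ExceptionalODE.
Variables (R : realFieldType) (al be : R) (F1 F2 : seq nat).
Local Notation k1 := (size F1).
Local Notation k2 := (size F2).
Local Notation K := {fraction {poly R}}.
Local Notation "p %:F" := (@FracField.tofrac {poly R} p).
Local Notation D := (@frac_deriv R : {additive K -> K}).
Local Notation row := (jacobi_row al be F1 F2).

Let DM : forall x y, D (x * y) = D x * y + x * D y := @frac_derivM R.
Let DP : forall p : {poly R}, D p%:F = p^`()%:F := @frac_deriv_poly R.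

Lemma exceptional_ode_poly k m (P Om : {poly R}) :
    k = (k1 + k2)%N -> (0 < k)%N ->
    \det (\matrix_(i < k.+1, j < k.+1) row m k i j) = P * (1 + 'X) ^+ (k2 * k2.-1) ->
    \det (\matrix_(i < k, j < k) row m k.-1 i.+1 j) = Om * (1 + 'X) ^+ (k2 * k2.-1) ->
    Om != 0 ->
  (1 - 'X ^+ 2) * (P^`()^`() * Om - 2%:P * P^`() * Om^`() + P * Om^`()^`())
  + ((be - al - 2 * k2%:R)%:P - (al + be + 2 * k1%:R + 2)%:P * 'X) * (P^`() * Om)
  + ((al - be + 2 * k2%:R)%:P + (2 * k1%:R + al + be)%:P * 'X) * (P * Om^`())
  - (k1%:R * (k1%:R + al + be + 1))%:P * (P * Om)
  = (- (m%:R * (m%:R + al + be + 1)))%:P * (P * Om).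
Proof.
move=> kE k0 detM detW Om0.
have [z [tau [zE tauE]]] := crum_jacobi kE k0 detM detW Om0; rewrite kE => zeq.
have OmF0 : Om%:F != 0 by rewrite tofrac_eq0.
have t0 := t_neq0 R.
have tk0 : (1 + xK R) ^+ k2 != 0 by rewrite expf_eq0 negb_and t0 orbT.
have h0 : ((1 + xK R) ^+ k2)^-1 != 0 by rewrite invr_eq0.
have dt : D (1 + xK R) = 1 by rewrite raddfD deriv_one // deriv_xK add0r.
have dh : D ((1 + xK R) ^+ k2)^-1 = - (k2%:R * ((1 + xK R) ^+ k2)^-1 / (1 + xK R)).
  rewrite (deriv_inv DM tk0) (deriv_expn DM k2 t0) dt.
  have gen (L : fieldType) (n a b : L) : a != 0 -> b != 0 ->
      - (n * a * 1 / b) / a ^+ 2 = - (n * a^-1 / b).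
    by move=> a0 b0; field; rewrite a0 b0.
  exact: (gen _ _ _ _ tk0 t0).
have := crum_gauge DM (deriv_xK R) (deriv_cst al) (deriv_cst be) t0 OmF0 h0 dh zE tauE zeq.
rewrite !DP => E; apply/eqP; rewrite -tofrac_eq; apply/eqP.
rewrite !(tofracD, tofracM, tofracN, tofracXn) -!/(cst _).
rewrite !(cstD, cstM, cstN, cst_nat, cst1); exact: E.
Qed.

Lemma det_Mmat_dvd n : (1 + 'X) ^+ (k2 * k2.-1) %| \det (Mmat al be F1 F2 n).
Proof.
apply: (@det_twist_dvd _ be k1.+1 k2 (Mmat al be F1 F2 n)
         (fun i => jacobi al (- be) (nth 0%N F2 i))) => i j.
by rewrite mxE /= ltnNge leq_addr /= addKn /rowF2 twist_jacobi scalerAr.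
Qed.

Lemma det_Wmat_dvd : (1 + 'X) ^+ (k2 * k2.-1) %| \det (Wmat al be F1 F2).
Proof.
apply: (@det_twist_dvd _ be k1 k2 _
         (fun i => jacobi al (- be) (nth 0%N F2 i))) => i j.
by rewrite mxE /= ltnNge leq_addr /= addKn /rowF2 twist_jacobi scalerAr subnS predn_sub.
Qed.

End ExceptionalODE.

(** * Degrees *)

Lemma has_topZ (R : comNzRingType) m (p : {poly R}) a c :
  has_top m p a -> has_top m (c *: p) (c * a).
Proof.
by move=> [sp <-]; split; [exact: leq_trans (size_scale_leq _ _) sp | exact: coefZ].
Qed.

Section Degree.
Variables (R : realFieldType) (al be : R).

Lemma poch_opp_nat f j : poch (- f%:R) j = (-1) ^+ j * (f ^_ j)%:R :> R.
Proof.
elim: j => [|j IHj]; first by rewrite /poch big_ord0 ffactn0 mul1r.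
rewrite /poch big_ord_recr /= -/(poch _ _) IHj ffactnSr natrM exprS.
have [le_jf|lt_fj] := leqP j f; first by rewrite natrB //; ring.
by rewrite (ffact_small lt_fj) !(mulr0, mul0r).
Qed.

(** The factor ['X^j] makes the expected degree the same along a row, as [has_top_det] requires. For
    [j > f] the Pochhammer symbol vanishes with the derivative. *)
Lemma has_top_rowF1 f j :
  has_top f ('X^j * rowF1 al be f j) ((jacobi al be f)`_f * poch (- f%:R) j).
Proof.
rewrite /rowF1; have := size_jacobi_leq al be f; move: (jacobi al be f) => p sp.
have coefE i : (j <= i)%N ->
    ('X^j * ((-1) ^+ j *: p^`(j)))`_i = (-1) ^+ j * (p`_i *+ i ^_ j).
  by move=> ji; rewrite coefXnM ltnNge ji /= coefZ coef_derivn subnKC.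
split.
  apply/leq_sizeP => i fi; have [ji|ij] := leqP j i; last by rewrite coefXnM ij.
  by rewrite coefE // nth_default ?mul0rn ?mulr0 // (leq_trans sp).
rewrite poch_opp_nat; have [jf|fj] := leqP j f; last first.
  by rewrite coefXnM fj ffact_small // !mulr0.
by rewrite coefE // -mulr_natr; ring.
Qed.

(** The top coefficient of a Jacobi polynomial depends only on the sum of its parameters, which is
    constant along the row. *)
Lemma has_top_rowF2 f j k : (j <= k)%N ->
  has_top (f + k) ('X^j * rowF2 al be f j (k - j))
    ((jacobi al (- be) f)`_f * poch (be - f%:R) j).
Proof.
move=> jk; rewrite /rowF2 -scalerAr [_`_f * _]mulrC; apply: has_topZ.
have -> : (f + k = j + ((k - j) + f))%N by lia.
rewrite -[_`_f]mul1r; apply: has_topM.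
  by split; rewrite ?size_polyXn ?coefXn ?eqxx.
rewrite -[_`_f]mul1r; apply: has_topM.
  have sX : size ((1 + 'X : {poly R}) ^+ (k - j)) = (k - j).+1.
    by rewrite addrC -[1]opprK -polyCN size_exp_XsubC.
  split; first by rewrite sX.
  have /monicP : (1 + 'X : {poly R}) ^+ (k - j) \is monic.
    by rewrite addrC -[1]/(1%:P) monic_exp ?monicXaddC.
  by rewrite lead_coefE sX.
split; first exact: size_jacobi_leq.
rewrite !coef_jacobi_top; congr (_ * gbinom _ _); ring.
Qed.

Variables (F1 F2 : seq nat).
Local Notation k1 := (size F1).
Local Notation k2 := (size F2).
Hypotheses (pF1 : posset F1) (pF2 : posset F2).

Lemma sum_F1_geq_bin : ('C(k1.+1, 2) <= \sum_(f <- F1) f)%N.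
Proof.
have /andP[srt /allP pos] := pF1.
have := @sum_uniq_geq_bin (0%N :: F1); rewrite big_cons /= add0n; apply.
rewrite (sorted_uniq ltn_trans ltnn srt) andbT.
by apply/negP => /pos.
Qed.

Lemma sum_F2_geq_bin : ('C(k2, 2) <= \sum_(f <- F2) f)%N.
Proof.
have /andP[srt _] := pF2.
by apply: sum_uniq_geq_bin; apply: (sorted_uniq ltn_trans ltnn srt).
Qed.

(** Minus the growth exponent at infinity of the function behind row [i]: [x^f] for the first row
    and [F1], [x^(f - be)] for [F2]. *)
Definition row_exponent m i : R :=
  (if (k1 < i)%N then be else 0) - (index_at F1 F2 m i)%:R.

(** Equality between rows of different types would give [be = f - g] with [f] in [F2]; then
    [be - last - 1] is a negative integer, since [f <= last], against (A2). *)
Lemma row_exponent_inj m :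
    m \notin F1 ->
    (F2 != [::] -> ~ negint (be - (last 0%N F2)%:R - 1)) ->
  injective (fun i : 'I_(k1 + k2).+1 => row_exponent m i).
Proof.
move=> mF1 A2.
have /andP[s1 _] := pF1; have /andP[s2 _] := pF2.
have u1 : uniq (m :: F1) by rewrite /= mF1 (sorted_uniq ltn_trans ltnn s1).
have u2 : uniq F2 := sorted_uniq ltn_trans ltnn s2.
have lastF2 f : f \in F2 -> (f <= last 0 F2)%N.
  move=> fs; have s2' : sorted leq F2 by apply: sub_sorted s2 => a b /ltnW.
  rewrite -nth_last -{1}(nth_index 0%N fs) (sorted_leq_nth leq_trans leqnn) //.
  - by rewrite inE index_mem.
  - by rewrite inE ltn_predL; case: (F2) fs.
  by rewrite -ltnS prednK ?index_mem //; case: (F2) fs.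
have idx1 i : (i <= k1)%N -> index_at F1 F2 m i = nth 0%N (m :: F1) i.
  by rewrite /index_at -cat_cons nth_cat /= ltnS => ->.
have idx2 i : (k1 < i)%N -> index_at F1 F2 m i = nth 0%N F2 (i - k1.+1).
  by rewrite /index_at -cat_cons nth_cat /= ltnS ltnNge => /negPf ->.
have cross i j : (i <= k1)%N -> (k1 < j)%N -> (j < (k1 + k2).+1)%N ->
    row_exponent m i <> row_exponent m j.
  rewrite /row_exponent => ik kj jk; rewrite kj ltnNge ik /= sub0r => E.
  set f := index_at F1 F2 m j in E *; set g := index_at _ _ _ _ in E.
  have lj : (j - k1.+1 < k2)%N by rewrite ltn_subLR // addSn.
  have fF2 : f \in F2 by rewrite /f idx2 // mem_nth.
  have nz : F2 != [::] by case: (F2) fF2.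
  apply: (A2 nz); exists (g + (last 0 F2 - f))%N.
  have lf := lastF2 f fF2; rewrite -natr1 natrD natrB //.
  have -> : be = f%:R - g%:R by rewrite E addrC subrK.
  ring.
move=> i j; have ii := ltn_ord i; have jj := ltn_ord j.
have [ik|ki] := leqP i k1; have [jk|kj] := leqP j k1.
- rewrite /row_exponent !ltnNge ik jk /= => /addrI /oppr_inj /eqP.
  by rewrite eqr_nat !idx1 // nth_uniq // => /eqP /val_inj.
- by move/(cross i j ik kj jj).
- by move/esym/(cross j i jk ki ii).
rewrite /row_exponent ki kj => /addrI /oppr_inj /eqP.
have idx_lt (l : 'I_(k1 + k2).+1) : (k1 < l)%N -> (l - k1.+1 < k2)%N.
  by move=> kl; rewrite ltn_subLR // addSn.
rewrite eqr_nat !idx2 // nth_uniq ?idx_lt // => /eqP E; apply/val_inj => /=.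
by rewrite -(subnKC ki) E subnKC.
Qed.

(** Scaling column [j] by ['X^j] adds [C(k+1,2)] to the degree. The coefficient at the expected
    degree is a product of Jacobi top coefficients and a Pochhammer determinant, all nonzero. *)
Lemma size_det_jacobi_row m :
    m \notin F1 -> ~ negint (al + be) ->
    (F2 != [::] -> ~ negint (al - be) /\ ~ negint (be - (last 0%N F2)%:R - 1)) ->
  let k := (k1 + k2)%N in
  (size (\det (\matrix_(i < k.+1, j < k.+1) jacobi_row al be F1 F2 m k i j))
     + 'C(k.+1, 2)
   = (m + \sum_(f <- F1) f + \sum_(f <- F2) f + k2 * k).+1)%N.
Proof.
move=> mF1 A1 A2 k; set A := \matrix_(_, _) _.
pose a i := (seed al be F1 F2 m i)`_(index_at F1 F2 m i).
pose V : 'M[R]_k.+1 := \matrix_(i, j) poch (row_exponent m i) j.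
pose deg (i : nat) := (index_at F1 F2 m i + (if (k1 < i)%N then k else 0))%N.
have top (i j : 'I_k.+1) :
    has_top (deg i) ((\matrix_(i, j) ((fun=> 1) i * 'X^j * A i j)) i j)
      ((\matrix_(i, j) (a i * (fun=> 1) j * V i j)) i j).
  have jk : (j <= k)%N by rewrite -ltnS.
  rewrite !mxE mul1r mulr1 /a /seed /deg /jacobi_row /row_exponent; case: ifP => _.
    exact: has_top_rowF2.
  by rewrite addn0 sub0r; apply: has_top_rowF1.
have [size_le top_coef] := has_top_det top.
rewrite (det_scale_rows_cols (fun=> 1)) big1 // mul1r in size_le top_coef.
rewrite (det_scale_rows_cols (fun i : 'I_k.+1 => a i)) [X in _ * X * _]big1 // in top_coef.
have top0 : (\prod_(j < k.+1) 'X^j * \det A)`_(\sum_(i < k.+1) deg i) != 0.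
  rewrite top_coef mulr1 mulf_neq0 //; last first.
    by apply: (det_poch_neq0 (row_exponent_inj mF1 _)) => /A2 [].
  apply/prodf_neq0 => i _; apply: coef_jacobi_top_neq0; case: ifP => [ki|_] //.
  have : (0 < k2)%N.
    rewrite -(ltn_add2l k1) addn0 (leq_trans ki) // -ltnS; exact: ltn_ord.
  by move: A2; case: (F2) => // f F A2 _; case: (A2 isT).
have sz : size (\prod_(j < k.+1) 'X^j * \det A) = (\sum_(i < k.+1) deg i).+1.
  apply/eqP; rewrite eqn_leq size_le ltnNge; apply/negP => /leq_sizeP/(_ _ (leqnn _)) E.
  by rewrite E eqxx in top0.
have XE : \prod_(j < k.+1) 'X^j = 'X^('C(k.+1, 2)) :> {poly R}.
  by rewrite prodrXr -bin2_sum big_mkord.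
have A0 : \det A != 0.
  by apply: contraNneq top0 => ->; rewrite mulr0 coef0.
move: sz; rewrite XE size_monicM ?monicXn // size_polyXn addSn /= addnC => ->.
congr _.+1; rewrite big_split /= [X in (_ + X)%N]big_ord_recl /=.
rewrite (big_tail _ _ (erefl k)) iter_addn_0 add0n [(k2 * k)%N]mulnC; congr (_ + _)%N.
transitivity (\sum_(f <- m :: F1 ++ F2) f)%N.
  by rewrite (big_nth 0%N) /= size_cat big_mkord.
by rewrite big_cons big_cat /= addnA.
Qed.

Lemma size_PF n :
    in_sigma F1 F2 n -> ~ negint (al + be) ->
    (F2 != [::] -> ~ negint (al - be) /\ ~ negint (be - (last 0%N F2)%:R - 1)) ->
  size (PF al be F1 F2 n) = n.+1.
Proof.
move=> /andP[un mF1] A1 A2.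
have := size_det_jacobi_row mF1 A1 A2; rewrite /= -MmatE => sz.
have sX : size ((1 + 'X : {poly R}) ^+ (k2 * k2.-1)) = (k2 * k2.-1).+1.
  by rewrite addrC -[1]opprK -polyCN size_exp_XsubC.
have X0 : (1 + 'X : {poly R}) ^+ (k2 * k2.-1) != 0.
  by rewrite -size_poly_gt0 sX.
rewrite /PF size_divp // sX /=; move: sz.
(* These bounds ensure that the natural number subtractions in [uF] are not truncated. *)
have := sum_F1_geq_bin; have := sum_F2_geq_bin.
have E0 i : ('C(i, 2) * 2 = i * i.-1)%N.
  by rewrite -[2%N in LHS]/(2`!) bin_ffact ffactnS ffactn1.
move: un; rewrite /uF.
have := E0 k2; have := E0 k1.+1; have := E0 (k1 + k2).+1; rewrite /=.
move: (size (\det (Mmat al be F1 F2 n))) => sM.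
move: (\sum_(f <- F1) f)%N (\sum_(f <- F2) f)%N => S1 S2.
move: 'C(_, _) 'C(_, _) 'C(_, _) => c c1 c2.
have -> : (k2 * k2.-1 = k2 * k2 - k2)%N by rewrite -subn1 mulnBr muln1.
have : (k2 <= k2 * k2)%N by case: (k2) => // l; rewrite mulnS leq_addr.
lia.
Qed.

End Degree.

(** * Degree and differential equation of the exceptional polynomials *)

Theorem theorem5p2 (R : realFieldType) (al be : R) (F1 F2 : seq nat) :
  posset F1 -> posset F2 -> (F1 ++ F2 != [::]) ->
  (* (A1) *)
  ~ negint al -> ~ negint be -> ~ negint (al + be) ->
  (* (A2) *)
  (F2 != [::] -> ~ negint (al - be) /\ ~ negint (be - (last 0%N F2)%:R - 1)) ->
  forall n : nat, in_sigma F1 F2 n ->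
    let P := PF al be F1 F2 n in
    let Om := OmegaF al be F1 F2 in
    let k1 := size F1 in let k2 := size F2 in
    size P = n.+1 /\
    forall x : R, Om.[x] != 0 ->
      let h1 := be - al - 2 * k2%:R - (al + be + 2 * k1%:R + 2) * x
                - 2 * (1 - x ^+ 2) * (Om^`().[x] / Om.[x]) in
      let h0 := - lam al be k1%:R
                + (al - be + 2 * k2%:R + (2 * k1%:R + al + be) * x)
                  * (Om^`().[x] / Om.[x])
                + (1 - x ^+ 2) * (Om^`(2).[x] / Om.[x]) in
      (1 - x ^+ 2) * (P^`(2)).[x] + h1 * (P^`()).[x] + h0 * P.[x]
        = - lam al be (n - uF F1 F2)%:R * P.[x].
Proof.
move=> pF1 pF2 F0 _ _ A1 A2 n ns P Om k1 k2; split; first exact: size_PF.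
move=> x Omx0 h1 h0.
have k_gt0 : (0 < size F1 + size F2)%N by rewrite -size_cat lt0n size_eq0.
(* [PF] and [OmegaF] are Euclidean quotients; divisibility makes them exact. *)
have detM : \det (Mmat al be F1 F2 n) = P * (1 + 'X) ^+ (k2 * k2.-1).
  by rewrite [RHS]divpK // det_Mmat_dvd.
have detW : \det (Wmat al be F1 F2) = Om * (1 + 'X) ^+ (k2 * k2.-1).
  by rewrite [RHS]divpK // det_Wmat_dvd.
rewrite MmatE in detM; rewrite (WmatE _ _ _ _ (n - uF F1 F2)) in detW.
have Om0 : Om != 0 by apply: contraNneq Omx0 => ->; rewrite horner0.
have := exceptional_ode_poly erefl k_gt0 detM detW Om0.
move/(congr1 (horner^~ x)).
rewrite !(hornerD, hornerN, hornerM, hornerXn, hornerX, hornerC).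
rewrite /h1 /h0 /lam !derivnS !derivn0 -/k1 -/k2.
move: (n - uF F1 F2)%N Omx0 => m {detM detW h1 h0}.
move: P.[x] P^`().[x] P^`()^`().[x] Om.[x] Om^`().[x] Om^`()^`().[x].
(* Multiplied by the nonzero value of [Om], the claim is the bilinear identity evaluated at [x]. *)
move=> p0 p1 p2 o0 o1 o2 o0n E; apply: (mulIf o0n).
transitivity ((- (m%:R * (m%:R + al + be + 1))) * (p0 * o0)); last by ring.
by apply: etrans E; field.
Qed.
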